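(* Let $Y=\xi+R\,\gamma+S\,X\sim\mathrm{GMN}_d(\xi,\Sigma,\gamma,H)$ with $\gamma\ne 0$, and suppose that the moments of $(R,S)$ up to the fourth order exist. Write $\mu_{hk}=\mathbb{E}\{R^hS^k\}$, $\alpha=(\gamma^\top\Sigma^{-1}\gamma)^{1/2}$, $\bar\mu_{20}=\mu_{20}-\mu_{10}^2$, and $$\bar\rho=\frac{\alpha^2\bar\mu_{20}}{\mu_{02}+\alpha^2\bar\mu_{20}}.$$ Let $R_0=R-\mu_{10}$, $T_0=\alpha^{-1}\gamma^\top\Sigma^{-1}X$ (so that $T_0\sim\mathrm{N}(0,1)$ is independent of $(R,S)$) and $Z_0=\alpha R_0+S\,T_0$. Then Mardia's measures of multivariate skewness and kurtosis of $Y$ are $$\beta_{1,d}=\mu_{02}^{-3}\left(3(d-1)(1-\bar\rho)\left(\mathbb{E}\{S^2Z_0\}\right)^2+(1-\bar\rho)^3\left(\mathbb{E}\{Z_0^3\}\right)^2\right),$$ $$\beta_{2,d}=\mu_{02}^{-2}\left((d+1)(d-1)\mu_{04}+2(d-1)(1-\bar\rho)\,\mathbb{E}\{S^2Z_0^2\}+(1-\bar\rho)^2\,\mathbb{E}\{Z_0^4\}\right),$$ where $$\mathbb{E}\{S^2Z_0\}=\alpha(\mu_{12}-\mu_{10}\mu_{02}),$$ $$\mathbb{E}\{S^2Z_0^2\}=\alpha^2(\mu_{22}-2\mu_{12}\mu_{10}+\mu_{10}^2\mu_{02})+\mu_{04},$$ $$\mathbb{E}\{Z_0^3\}=\alpha^3(\mu_{30}-3\mu_{20}\mu_{10}+2\mu_{10}^3)+3\alpha(\mu_{12}-\mu_{10}\mu_{02}),$$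 $$\mathbb{E}\{Z_0^4\}=\alpha^4(\mu_{40}-4\mu_{30}\mu_{10}+6\mu_{20}\mu_{10}^2-3\mu_{10}^4)+6\alpha^2(\mu_{22}-2\mu_{12}\mu_{10}+\mu_{10}^2\mu_{02})+3\mu_{04}.$$
   Context: Generalized mixtures of normals (GMN). Let $\Sigma$ be a $d\times d$ symmetric positive definite matrix and $\xi,\gamma\in\mathbb{R}^d$. Let $X\sim\mathrm{N}_d(0,\Sigma)$ be a $d$-dimensional normal variable and $U,V$ univariate random variables such that $X,U,V$ are mutually independent. Let $r(u,v)$ be a real-valued function and $s(u,v)$ a positive-valued function, and let $R=r(U,V)$, $S=s(U,V)$ be the resulting random variables, so that $(R,S)$ is independent of $X$. Denote by $H$ the joint distribution (function) of $(R,S)$. If $Y=\xi+R\,\gamma+S\,X$, one writes $Y\sim\mathrm{GMN}_d(\xi,\Sigma,\gamma,H)$. Mardia's measures: for a $d$-dimensional random variable $Z$ with mean vector $\mu_Z$ and variance matrix $\Sigma_Z$ (nonsingular), and $Z'$ an independent copy of $Z$, $$\beta_{1,d}=\mathbb{E}\left\{\left[(Z-\mu_Z)^\top\Sigma_Z^{-1}(Z'-\mu_Z)\right]^3\right\},\qquad \beta_{2,d}=\mathbb{E}\left\{\left[(Z-\mu_Z)^\top\Sigma_Z^{-1}(Z-\mu_Z)\right]^2\right\}.$$ *)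

(* Defs.v *)
From HB Require Import structures.
From mathcomp Require Import all_boot all_order all_algebra.
From mathcomp Require Import all_classical all_reals all_analysis.

Set Implicit Arguments.
Unset Strict Implicit.
Unset Printing Implicit Defensive.

Import Order.TTheory GRing.Theory Num.Theory.
Import numFieldNormedType.Exports.

Local Open Scope classical_set_scope.
Local Open Scope ring_scope.

Definition posdef_mx (K : realType) (d : nat) (A : 'M[K]_d) : Prop :=
  A^T = A /\ forall x : 'cV[K]_d, x != 0 -> 0 < (x^T *m A *m x) 0 0.

Section RandomVectors.
Context (K : realType) (disp : measure_display) (T : measurableType disp).
Variable P : probability T K.

Definition sigma_rv d' (T' : measurableType d') (Z : T -> T') : set (set T) :=
  preimage_set_system [set: T] Z measurable.

Definition sigma_rvec d (Z : T -> 'cV[K]_d) : set (set T) :=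
  g_sigma_preimage (fun i w => Z w i 0).

Definition independent2 (F G : set (set T)) : Prop :=
  forall A B, F A -> G B -> P (A `&` B) = (P A * P B)%E.

(* Mutual independence of three sigma-algebras: the product rule for two of
   them is the case where the third event is the whole space. *)
Definition independent3 (F G H : set (set T)) : Prop :=
  forall A B C, F A -> G B -> H C ->
    P (A `&` B `&` C) = (P A * P B * P C)%E.

(* As in [normal_prob], the second parameter is the standard deviation. *)
Definition has_normal_law (Z : T -> K) (m sd : K) : Prop :=
  measurable_fun [set: T] Z /\
  forall A, measurable A -> P (Z @^-1` A) = normal_prob m sd A.

(* Z ~ N_d(mu, Sigma) for positive definite Sigma, defined by requiring every
   nontrivial linear combination a^T Z to be N(a^T mu, a^T Sigma a).  The case
   a = 0 is excluded because [normal_prob m 0] is not the Dirac measure at m. *)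
Definition mvnormal d (Z : T -> 'cV[K]_d) (mu : 'cV[K]_d) (Sigma : 'M[K]_d)
    : Prop :=
  (forall i, measurable_fun [set: T] (fun w => Z w i 0)) /\
  forall a : 'cV[K]_d, a != 0 ->
    has_normal_law (fun w => (a^T *m Z w) 0 0)
      ((a^T *m mu) 0 0) (Num.sqrt ((a^T *m Sigma *m a) 0 0)).

(* Y = xi + R gamma + S X ~ GMN_d(xi, Sigma, gamma, H) *)
Record GMN d (xi : 'cV[K]_d) (Sigma : 'M[K]_d) (gamma : 'cV[K]_d)
    (H : probability (K * K)%type K)
    (X : T -> 'cV[K]_d) (R S : T -> K) (Y : T -> 'cV[K]_d) : Prop := {
  gmn_posdef : posdef_mx Sigma ;
  gmn_normal : mvnormal X 0 Sigma ;
  gmn_mixing : exists (U V : {RV P >-> K}) (r s : {mfun (K * K)%type >-> K}),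
    [/\ independent3 (sigma_rvec X) (sigma_rv U) (sigma_rv V),
        (forall uv, 0 < s uv),
        (forall w, R w = r (U w, V w)) &
        (forall w, S w = s (U w, V w))] ;
  gmn_joint : forall A : set (K * K), measurable A ->
    H A = P ((fun w => (R w, S w)) @^-1` A) ;
  gmn_sum : forall w, Y w = xi + R w *: gamma + S w *: X w
}.

Definition joint_moment (R S : T -> K) (h k : nat) : K :=
  fine ('E_P[fun w => (R w ^+ h * S w ^+ k)%R])%E.

Definition mean_vec d (Z : T -> 'cV[K]_d) : 'cV[K]_d :=
  \col_i fine ('E_P[fun w => (Z w i 0)%R])%E.

Definition var_mx d (Z : T -> 'cV[K]_d) : 'M[K]_d :=
  \matrix_(i, j) fine (covariance P (fun w => Z w i 0) (fun w => Z w j 0)).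

Definition mahalanobis d (Z : T -> 'cV[K]_d) (x y : 'cV[K]_d) : K :=
  ((x - mean_vec Z)^T *m invmx (var_mx Z) *m (y - mean_vec Z)) 0 0.

(* On the product space, w |-> Z w.2 is an independent copy of w |-> Z w.1. *)
Definition mardia_skewness d (Z : T -> 'cV[K]_d) : \bar K :=
  ('E_(P \x P)[fun w : T * T => (mahalanobis Z (Z w.1) (Z w.2) ^+ 3)%R])%E.

Definition mardia_kurtosis d (Z : T -> 'cV[K]_d) : \bar K :=
  ('E_P[fun w => (mahalanobis Z (Z w) (Z w) ^+ 2)%R])%E.

End RandomVectors.

(* Main.v *)
Require Import Defs.
From HB Require Import structures.
From mathcomp Require Import all_boot all_order all_algebra.
From mathcomp Require Import all_classical all_reals all_analysis.
From mathcomp Require Import measurable_realfun.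
From mathcomp Require Import ring lra.

Set Implicit Arguments.
Unset Strict Implicit.
Unset Printing Implicit Defensive.

Import Order.TTheory GRing.Theory Num.Theory.
Import numFieldNormedType.Exports.

Local Open Scope classical_set_scope.
Local Open Scope ring_scope.

(** Write [Y - E Y = R0 gamma + S X] with [R0 = R - mu10]. The variance of [Y]
    is [V = m gamma gamma^T + mu02 Sigma], [m] being the variance of [R], a
    rank-one update of a multiple of [Sigma]. Put
    [t = alpha^-1 Sigma^-1 gamma], so that [t^T X] is the [T0] of the theorem
    and [t^T Sigma t = 1], and split [Sigma^-1 = t t^T + Q]. The residual [Q] kills [gamma], satisfies
    [Q Sigma Q = Q] and [Q Sigma t = 0], and [Sigma Q] has trace [d - 1]. The
    Sherman--Morrison formula ([rank_one_update_inverse]) then reads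
    [V^-1 = mu02^-1 (Q + (1 - rhobar) t t^T)], whence for two points [w], [w']
    the Mahalanobis product is
<<
      mu02^-1 ((1 - rhobar) Z0(w) Z0(w') + S(w) S(w') X(w)^T Q X(w')).
>>
    For the kurtosis, put [w' = w] and square: only the moments of [Z0] and of
    the quadratic form [q = X^T Q X] are needed. Since [q] involves only
    directions uncorrelated with [T0], Isserlis' formula for Gaussian fourth
    moments ([gaussian_quadruple]) gives [E q = d - 1], [E(q T0) = 0],
    [E(q T0^2) = d - 1] and [E q^2 = (d - 1)(d + 1)], and the independence of
    [X] and [(R, S)] does the rest ([has_mixture]).

    For the skewness, integrate first in [w'] (Fubini). With [w] fixed, the
    Mahalanobis product is an affine form [p R0 + S a^T X] in [w'], whose third
    moment is [p^3 E(R0^3) + 3 p E(R0 S^2) a^T Sigma a]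
    ([mixture_form_moment3]). Here [p] is a multiple of [Z0(w)] and
    [a^T Sigma a] a combination of [Z0(w)^2] and [S(w)^2 q(w)], so that the
    integral in [w] reduces to [E(Z0^3)] and [E(S^2 Z0 q)]. The integrability
    required by Fubini follows by expanding the cube in coordinates
    ([integrable_cube_bilinear]).

    Joint normality is only known through the laws of the linear forms [a^T X].
    Mixed moments are recovered from powers of linear forms by polarization,
    and the one-dimensional moments come from integration by parts against the
    normal density. *)

(** * Calculus of finite expectations *)

Section HasExpectation.
Context (K : realType) (disp : measure_display) (T : measurableType disp).
Variable P : probability T K.

(** Integrability and the value of the integral are carried together, so that
    each computation rule delivers both at once. *)
Definition has_expectation (f : T -> K) (v : K) : Prop :=
  P.-integrable [set: T] (fun w => (f w)%:E) /\ (\int[P]_w (f w)%:E = v%:E)%E.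

Lemma has_expectation_eq f g u v :
  has_expectation f u -> f =1 g -> u = v -> has_expectation g v.
Proof. by move=> + /funext <- <-. Qed.

Lemma integrable_has_expectation f :
  P.-integrable [set: T] (fun w => (f w)%:E) ->
  has_expectation f (fine 'E_P[f])%E.
Proof.
by move=> fi; split => //; rewrite unlock fineK//; exact: integrable_fin_num.
Qed.

Lemma expectationE f v : has_expectation f v -> 'E_P[f]%E = v%:E.
Proof. by move=> [_ <-]; rewrite unlock. Qed.

Lemma has_expectation_cst c : has_expectation (fun=> c) c.
Proof.
split; first by apply: finite_measure_integrable_cst.
by rewrite integral_cst// [X in (_ * X)%E]probability_setT mule1.
Qed.

Lemma has_expectationD f g u v : has_expectation f u -> has_expectation g v ->
  has_expectation (fun w => f w + g w) (u + v).
Proof.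
move=> [fi fu] [gi gv]; split.
  by apply: eq_integrable (integrableD measurableT fi gi).
by rewrite EFinD -fu -gv -integralD.
Qed.

Lemma has_expectationZ c f u : has_expectation f u ->
  has_expectation (fun w => c * f w) (c * u).
Proof.
move=> [fi fu]; split.
  by apply: eq_integrable (integrableZl measurableT c fi).
by rewrite EFinM -fu -integralZl.
Qed.

Lemma has_expectation_sum (I : Type) (r : seq I) (f : I -> T -> K) u :
  (forall i, has_expectation (f i) (u i)) ->
  has_expectation (fun w => \sum_(i <- r) f i w) (\sum_(i <- r) u i).
Proof.
move=> fu; elim: r => [|i r IHr].
  apply: has_expectation_eq (has_expectation_cst 0) _ _ => [w|];
    by rewrite big_nil.
apply: has_expectation_eq (has_expectationD (fu i) IHr) _ _ => [w|];
  by rewrite big_cons.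
Qed.

Lemma has_expectation_measurable f u :
  has_expectation f u -> measurable_fun [set: T] f.
Proof. by move=> [/measurable_int/measurable_EFinP]. Qed.

Lemma has_expectation_unique f u v :
  has_expectation f u -> has_expectation f v -> u = v.
Proof. by move=> [_ fu] [_]; rewrite fu => -[]. Qed.

End HasExpectation.

(** * Products of independent variables *)

Section Tensor.
Context (K : realType) (d1 d2 : measure_display) (T1 : measurableType d1)
  (T2 : measurableType d2) (P1 : probability T1 K) (P2 : probability T2 K).

Lemma integrable_tensor (f : T1 -> K) (g : T2 -> K) u v :
  has_expectation P1 f u -> has_expectation P2 g v ->
  (P1 \x P2)%E.-integrable [set: T1 * T2] (fun x => (f x.1 * g x.2)%:E).
Proof.
move=> hf hg.
have mf := has_expectation_measurable hf.
have mg := has_expectation_measurable hg.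
have mfg : measurable_fun [set: T1 * T2] (fun x => (f x.1 * g x.2)%:E).
  apply/measurable_EFinP; apply: measurable_funM.
    exact: (measurableT_comp mf).
  exact: (measurableT_comp mg).
apply/integrable12ltyP => //=.
under eq_integral => x _.
  under eq_integral => y _ do rewrite normrM EFinM.
  rewrite ge0_integralZl//; last exact/measurable_EFinP/measurableT_comp.
  over.
rewrite ge0_integralZr//.
- case: hf hg => /integrableP[_ fi] _ [/integrableP[_ gi] _].
  by rewrite lte_mul_pinfty// ?ge0_fin_numE//; exact: integral_ge0.
- exact/measurable_EFinP/measurableT_comp.
- exact: integral_ge0.
Qed.

Lemma integral_tensor (f : T1 -> K) (g : T2 -> K) u v :
  has_expectation P1 f u -> has_expectation P2 g v ->
  (\int[P1 \x P2]_x (f x.1 * g x.2)%:E = (u * v)%:E)%E.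
Proof.
move=> hf hg; rewrite -integral12_prod_meas1; last exact: integrable_tensor hf hg.
rewrite /fubini_F /=.
under eq_integral => x _.
  under eq_integral => y _ do rewrite EFinM.
  rewrite integralZl//= ?hg.2; last exact: hg.1.
  over.
by rewrite /= integralZr// ?hf.2 //; exact: hf.1.
Qed.

End Tensor.

Section Independence.
Context (K : realType) (disp : measure_display) (T : measurableType disp).
Variable P : probability T K.

Lemma independent2_subset (F F' G G' : set (set T)) :
  F' `<=` F -> G' `<=` G -> independent2 P F G -> independent2 P F' G'.
Proof. by move=> F'F G'G FG A B /F'F FA /G'G GB; exact: FG. Qed.

(** The joint law of [(f, g)] agrees with the product of the two laws on
    rectangles, hence everywhere; the product rule is then Fubini's theorem for
    [x * y] under a product measure. *)
Lemma has_expectationM f g u v : independent2 P (sigma_rv f) (sigma_rv g) ->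
  has_expectation P f u -> has_expectation P g v ->
  has_expectation P (fun w => f w * g w) (u * v).
Proof.
move=> fg hf hg.
have mf := has_expectation_measurable hf.
have mg := has_expectation_measurable hg.
pose fR : {mfun T >-> K} := HB.pack f (isMeasurableFun.Build _ _ _ _ f mf).
pose gR : {mfun T >-> K} := HB.pack g (isMeasurableFun.Build _ _ _ _ g mg).
have mh : measurable_fun [set: T] (fun w => (f w, g w)).
  by apply/measurable_fun_pairP.
pose hR : {mfun T >-> (K * K)%type} :=
  HB.pack (fun w => (f w, g w)) (isMeasurableFun.Build _ _ _ _ _ mh).
have lawE A : measurable A ->
    (distribution P fR \x distribution P gR)%E A = distribution P hR A.
  apply: product_measure_unique => B C mB mC.
  by apply: (fg (f @^-1` B) (g @^-1` C)); [exists B|exists C] => //;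
    rewrite setTI.
have mid : measurable_fun [set: K] (fun x : K => x%:E) by apply/measurable_EFinP.
have law (X : {mfun T >-> K}) w :
    has_expectation P X w -> has_expectation (distribution P X) id w.
  move=> hX; split.
    by apply: integrable_pushforward => //; rewrite preimage_setT; exact: hX.1.
  rewrite /= integral_pushforward//; last by rewrite preimage_setT; exact: hX.1.
  by rewrite preimage_setT; exact: hX.2.
have hf' := law fR _ hf.
have hg' := law gR _ hg.
have mM : measurable_fun [set: K * K] (fun x : K * K => (x.1 * x.2)%:E).
  by apply/measurable_EFinP; apply: measurable_funM.
have mhM : measurable_fun [set: T] (fun w => (f w * g w)%:E).
  exact: (measurableT_comp mM mh).
have iM : P.-integrable [set: T] (fun w => (f w * g w)%:E).
  have /integrableP[_] := integrable_tensor hf' hg'.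
  rewrite (eq_measure_integral (distribution P hR)); last first.
    by move=> A mA _; exact: lawE.
  rewrite ge0_integral_pushforward//; last exact/measurableT_comp.
  by rewrite preimage_setT => iM; apply/integrableP; split.
split => //; rewrite -(integral_tensor hf' hg').
rewrite (eq_measure_integral (distribution P hR)); last first.
  by move=> A mA _; exact: lawE.
by rewrite integral_pushforward//; rewrite preimage_setT.
Qed.

End Independence.

(** * Moments of the normal distribution *)

Section NormalMoments.
Context (K : realType).
Local Notation mu := (@lebesgue_measure K).

(** The Radon--Nikodym derivative of [normal_prob] is almost everywhere the
    density, which turns integrals for the law into Lebesgue integrals. *)
Lemma ge0_integral_normal_prob (m s : K) (f : K -> \bar K) :
  (forall x, 0 <= f x)%E -> measurable_fun [set: K] f ->
  (\int[normal_prob m s]_x f x = \int[mu]_x (f x * (normal_pdf m s x)%:E))%E.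
Proof.
move=> f0 mf; have dom := normal_prob_dominates m s.
rewrite -(charge.Radon_Nikodym_SigmaFinite.change_of_variables dom)//=.
have iRN := charge.Radon_Nikodym_SigmaFinite.f_integrable dom.
have mpdf : measurable_fun [set: K] (fun x => (normal_pdf m s x)%:E).
  by apply/measurable_EFinP; exact: measurable_normal_pdf.
apply: ae_eq_integral => //.
- by apply: emeasurable_funM => //; exact: measurable_int iRN.
- exact: emeasurable_funM.
- apply: ae_eqe_mul2l; apply: integral_ae_eq => // E _ mE.
  by rewrite -charge.Radon_Nikodym_SigmaFinite.f_integral.
Qed.

Variable s : K.
Hypothesis s0 : s != 0.
Local Notation phi := (normal_pdf 0 s).

Lemma normal_pdf0E x : phi x = normal_peak s * expR (- x ^+ 2 / (s ^+ 2 *+ 2)).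
Proof. by rewrite normal_pdfE// /normal_fun subr0. Qed.

Lemma is_derive_normal_pdf (x : K) :
  is_derive x (1 : K) (fun y : K => - s ^+ 2 * phi y) (x * phi x).
Proof.
pose h (y : K) : K := - (s ^+ 2 *+ 2)^-1 * y ^+ 2.
have dh : is_derive x (1 : K) h (- (s ^+ 2 *+ 2)^-1 * (2 * x)).
  apply: is_derive_eq; rewrite !scaler1 /=.
  by rewrite /GRing.scale /= mulr2n mulrDl !mul1r.
rewrite [X in is_derive _ _ X](_ : _ =
    (fun y => (- s ^+ 2 * normal_peak s) * (expR \o h) y)); last first.
  apply/funext => y; rewrite normal_pdf0E mulrA /h /=.
  by congr (_ * expR _); field.
have de := is_derive1_comp (is_derive_expR (h x)) dh.
apply: is_derive_eq (is_deriveZ (- s ^+ 2 * normal_peak s) de) _.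
rewrite /GRing.scale /= normal_pdf0E /h.
rewrite [X in expR X](_ : _ = - x ^+ 2 / (s ^+ 2 *+ 2)); last by field.
by field.
Qed.

Lemma cvg_exprn_normal_pdf k :
  (n.+1%:R ^+ k.+1 * phi n.+1%:R) @[n --> \oo] --> (0 : K).
Proof.
pose c : K := normal_peak s * ((s ^+ 2 *+ 2) ^+ k.+1 * k.+1`!%:R).
have c0 : 0 <= c.
  by rewrite !mulr_ge0 ?normal_peak_ge0 ?exprn_ge0 ?mulrn_wge0 ?sqr_ge0.
apply: (@squeeze_cvgr _ _ _ _ (cst 0) (fun n => c * harmonic n)).
- near=> n; apply/andP; split.
    by rewrite mulr_ge0 ?exprn_ge0 ?normal_pdf_ge0.
  set x : K := n.+1%:R; have x1 : 1 <= x by rewrite ler1n.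
  have x0 : 0 < x by exact: lt_le_trans x1.
  have s20 : 0 < s ^+ 2 *+ 2 by rewrite pmulrn_lgt0// exprn_even_gt0.
  pose y := x ^+ 2 / (s ^+ 2 *+ 2).
  have y0 : 0 < y by rewrite divr_gt0// exprn_gt0.
  (* e^y dominates the single term y^(k+1)/(k+1)! of its series *)
  have eV : expR (- y) <= k.+1`!%:R / y ^+ k.+1.
    have yk : 0 < y ^+ k.+1 / k.+1`!%:R.
      by rewrite divr_gt0 ?exprn_gt0// ltr0n fact_gt0.
    rewrite expRN -[leRHS]invf_div lef_pV2 ?posrE ?expR_gt0//.
    by apply: le_trans (expR_ge1Dxn k (ltW y0)); rewrite lerDr.
  rewrite normal_pdf0E mulNr -/y mulrCA -mulrA; apply: ler_wpM2l.
    exact: normal_peak_ge0.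
  apply: (@le_trans _ _ (x ^+ k.+1 * (k.+1`!%:R / y ^+ k.+1))).
    by apply: ler_wpM2l => //; rewrite exprn_ge0// ltW.
  rewrite /y expr_div_n -exprM mulnC exprM.
  rewrite [leLHS](_ : _ =
    (s ^+ 2 *+ 2) ^+ k.+1 * k.+1`!%:R * (x ^+ k.+1)^-1); last first.
    by field; rewrite !expf_neq0 ?gt_eqF.
  apply: ler_wpM2l; first by rewrite mulr_ge0// exprn_ge0// ltW.
  rewrite /harmonic -/x lef_pV2 ?posrE ?exprn_gt0// exprS.
  by rewrite ler_peMr ?exprn_ege1// ltW.
- exact: cvg_cst.
- rewrite -(mulr0 c); apply: cvgM; [exact: cvg_cst|exact: cvg_harmonic].
Unshelve. all: by end_near. Qed.

Lemma continuous_exprn_normal_pdf k : continuous (fun x : K => x ^+ k * phi x).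
Proof.
move=> x; apply: cvgM; last exact: continuous_normal_pdf.
exact: exprn_continuous.
Qed.

(** Integration by parts, with [- s^2 phi] as a primitive of [x phi]. *)
Lemma exprn_normal_pdf_itv k (b : K) : 0 < b ->
  (\int[mu]_(x in `[0%R, b]) (x ^+ k.+2 * phi x)%:E =
   (- s ^+ 2 * (b ^+ k.+1 * phi b))%:E +
   (s ^+ 2 * k.+1%:R)%:E * \int[mu]_(x in `[0%R, b]) (x ^+ k * phi x)%:E)%E.
Proof.
move=> b0.
pose F (x : K) : K := x ^+ k.+1; pose f (x : K) : K := k.+1%:R * x ^+ k.
pose G (x : K) : K := - s ^+ 2 * phi x; pose g (x : K) : K := x * phi x.
have dF x : is_derive x (1 : K) F (f x).
  apply: DeriveDef; first exact: exprn_derivable.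
  by rewrite exp_derive /GRing.scale /= mulr1.
have dG x : is_derive x (1 : K) G (g x) by exact: is_derive_normal_pdf.
have dLR (H h : K -> K) : (forall x, is_derive x (1 : K) H (h x)) ->
    derivable_oo_LRcontinuous H 0 b.
  move=> dH; have cH x : {for x, continuous H}.
    by apply: differentiable_continuous; apply/derivable1_diffP; exact: ex_derive.
  split=> [x _| |]; first exact: ex_derive.
    by apply: cvg_at_right_filter; exact: cH.
  by apply: cvg_at_left_filter; exact: cH.
have cf : continuous f.
  by move=> x; apply: cvgM; [exact: cvg_cst|exact: exprn_continuous].
have cg : continuous g.
  by move=> x; apply: cvgM; [exact: cvg_id|exact: continuous_normal_pdf].
have derE (H h : K -> K) : (forall x, is_derive x (1 : K) H (h x)) ->
    {in `]0, b[, H^`()%classic =1 h}.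
  by move=> dH x _; rewrite derive1E; exact: derive_val.
have := integration_by_parts b0 (continuous_subspaceT cf) (dLR _ _ dF)
  (derE _ _ dF) (continuous_subspaceT cg) (dLR _ _ dG) (derE _ _ dG).
rewrite /F /G /f /g.
under eq_integral do rewrite mulrA -exprSr.
move=> ->; rewrite expr0n /= mul0r subr0; congr (_ + _)%E.
  by congr EFin; rewrite mulrCA.
have E x : k.+1%:R * x ^+ k * (- s ^+ 2 * phi x) =
    - (s ^+ 2 * k.+1%:R) * (x ^+ k * phi x) by ring.
under eq_integral do rewrite E EFinM.
rewrite integralZl//= ?EFinN ?mulNe ?oppeK//.
apply: continuous_compact_integrable; first exact: segment_compact.
exact/continuous_subspaceT/continuous_exprn_normal_pdf.
Qed.

(** The boundary term of [exprn_normal_pdf_itv] vanishes at infinity. Absolute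
    values make the integrands nonnegative on the whole line, as monotone
    convergence of the truncated integrals requires. *)
Lemma exprn_normal_pdf_y k :
  (\int[mu]_(x in `[0%R, +oo[) (x ^+ k.+2 * phi x)%:E =
   (s ^+ 2 * k.+1%:R)%:E *
     \int[mu]_(x in `[0%R, +oo[) (x ^+ k * phi x)%:E)%E.
Proof.
pose h k (x : K) : K := `|x| ^+ k * phi x.
have h0 j x : 0 <= h j x by rewrite mulr_ge0 ?exprn_ge0 ?normal_pdf_ge0.
have mh j : measurable_fun [set: K] (h j).
  apply: measurable_funM; last exact: measurable_normal_pdf.
  by apply: measurable_funX; exact: normr_measurable.
have hE j (A : set K) : A `<=` `[0, +oo[%classic ->
    (\int[mu]_(x in A) (x ^+ j * phi x)%:E = \int[mu]_(x in A) (h j x)%:E)%E.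
  move=> A0; apply: eq_integral => x /set_mem /A0 /=.
  by rewrite in_itv /= andbT /h => x0; rewrite ger0_norm.
have sub0 (b : K) : `[0%R, b]%classic `<=` `[0%R, +oo[%classic.
  by move=> x /=; rewrite !in_itv /= => /andP[->].
have cvgh j := @ge0_cvgn_integral K mu _ (h0 j) (mh j).
rewrite !hE//.
have lhs := cvgh k.+2.
pose I := ((s ^+ 2 * k.+1%:R)%:E * \int[mu]_(x in `[0%R, +oo[) (h k x)%:E)%E.
suff rhs : (\int[mu]_(x in `[0%R, n%:R]) (h k.+2 x)%:E @[n --> \oo] --> 0 + I)%E.
  by rewrite -/I -(add0e I); exact: cvg_unique lhs rhs.
rewrite -cvg_shiftS /=.
have -> : (fun n => \int[mu]_(x in `[0%R, n.+1%:R]) (h k.+2 x)%:E)%E =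
    (fun n => (- s ^+ 2 * (n.+1%:R ^+ k.+1 * phi n.+1%:R))%:E +
      (s ^+ 2 * k.+1%:R)%:E * \int[mu]_(x in `[0%R, n.+1%:R]) (h k x)%:E)%E.
  apply/funext => n; rewrite -!hE//; exact: exprn_normal_pdf_itv.
apply: cvgeD => //.
- apply: cvg_EFin; first exact: nearW.
  have := cvgM (cvg_cst (- s ^+ 2)) (cvg_exprn_normal_pdf k).
  by rewrite mulr0; apply.
- apply: cvgeZl => //.
  by have := cvgh k; rewrite -cvg_shiftS.
Qed.

Lemma even_moment_normal_rec k : ~~ odd k ->
  (\int[normal_prob 0 s]_x (x ^+ k.+2)%:E =
   (s ^+ 2 * k.+1%:R)%:E * \int[normal_prob 0 s]_x (x ^+ k)%:E)%E.
Proof.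
move=> ek.
have E j : ~~ odd j -> (\int[normal_prob 0 s]_x (x ^+ j)%:E =
    2%:E * \int[mu]_(x in `[0%R, +oo[) (x ^+ j * phi x)%:E)%E.
  move=> ej; rewrite ge0_integral_normal_prob; first last.
  - by apply/measurable_EFinP; exact: measurable_funX.
  - by move=> x; rewrite lee_fin exprn_even_ge0.
  rewrite (ge0_symfun_integralT (f := fun x => x ^+ j * phi x)).
  - congr (_ * _)%E; congr (integral _ _ _).
    by apply/seteqP; split => x /=; rewrite in_itv /= andbT.
  - by move=> x; rewrite mulr_ge0 ?exprn_even_ge0// normal_pdf_ge0.
  - exact: continuous_exprn_normal_pdf.
  - move=> x /=; rewrite !normal_pdf0E sqrrN exprNn -signr_odd (negbTE ej).
    by rewrite expr0 mul1r.
by rewrite !E//= ?negbK// exprn_normal_pdf_y muleCA.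
Qed.

Lemma moment2_normal : (\int[normal_prob 0 s]_x (x ^+ 2)%:E = (s ^+ 2)%:E)%E.
Proof.
rewrite even_moment_normal_rec//; under eq_integral do rewrite expr0.
by rewrite integral_cst// [X in (_ * (_ * X))%E]probability_setT !mule1 mulr1.
Qed.

Lemma moment4_normal :
  (\int[normal_prob 0 s]_x (x ^+ 4)%:E = (3 * s ^+ 4)%:E)%E.
Proof.
rewrite even_moment_normal_rec// moment2_normal -EFinM; congr EFin; ring.
Qed.

End NormalMoments.

(** * Generated sigma-algebras and independence *)

Section PairIndependence.
Context (K : realType) (disp : measure_display) (T : measurableType disp).
Variable P : probability T K.

(** For fixed [A] in [F], the two finite measures
    [B |-> P (A and (U, V) in B)] and [B |-> P A * P ((U, V) in B)] agree on
    rectangles, which form a generating pi-system. *)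
Lemma independent3_pair (F : set (set T)) (U V : {RV P >-> K}) :
  F `<=` measurable -> F setT ->
  independent3 P F (sigma_rv U) (sigma_rv V) ->
  independent2 P F (sigma_rv (fun w => (U w, V w))).
Proof.
move=> Fm FT ind A _ FA [B mB <-]; rewrite setTI.
have mA := Fm _ FA.
have mUV : measurable_fun [set: T] (fun w => (U w, V w)).
  exact: measurable_fun_pair.
pose UV : {mfun T >-> (K * K)%type} :=
  HB.pack (fun w => (U w, V w)) (isMeasurableFun.Build _ _ _ _ _ mUV).
have sT (Z : {RV P >-> K}) C : measurable C -> sigma_rv Z (Z @^-1` C).
  by move=> mC; exists C => //; rewrite setTI.
pose PA : {nonneg K} := NngNum (fine_ge0 (measure_ge0 P A)).
have [m1 m1E] : exists m1 : {measure set (K * K) -> \bar K},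
    forall C, m1 C = P (A `&` UV @^-1` C).
  unshelve eexists
    (pushforward (mrestr P mA) UV : {measure set (K * K) -> \bar K}) => //.
  by move=> C; rewrite /pushforward /mrestr setIC.
pose m2 : {measure set (K * K) -> \bar K} := mscale PA (distribution P UV).
have m2E C : m2 C = (P A * P (UV @^-1` C))%E.
  by rewrite /m2 /= /mscale /= fineK// fin_num_measure.
suff : m1 B = m2 B by rewrite m1E m2E.
apply: (measure_unique [set C1 `*` C2 | C1 in measurable & C2 in measurable]
  (fun=> setT)) => //.
- by rewrite measurable_prod_measurableType.
- move=> X Y [X1 mX1 [X2 mX2 <-{X}]] [Y1 mY1 [Y2 mY2 <-{Y}]].
  exists (X1 `&` Y1); first exact: measurableI.
  by exists (X2 `&` Y2); [exact: measurableI|rewrite setXI].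
- by move=> _; exists setT => //; exists setT => //; rewrite setXTT.
- by rewrite bigcup_const.
- move=> _ [C1 mC1 [C2 mC2 <-]]; rewrite m1E m2E.
  have -> : UV @^-1` (C1 `*` C2) = U @^-1` C1 `&` V @^-1` C2 by [].
  rewrite setIA ind//; try exact: sT.
  have := ind setT _ _ FT (sT U _ mC1) (sT V _ mC2).
  by rewrite setTI probability_setT mul1e => ->; rewrite muleA.
- by move=> _; rewrite m1E -ge0_fin_numE// fin_num_measure// preimage_setT setIT.
Qed.

End PairIndependence.

Section RandomVectorSigma.
Context (K : realType) (disp : measure_display) (T : measurableType disp).
Variables (d : nat) (X : T -> 'cV[K]_d).

Let G := \big[setU/set0]_(i < d)
  preimage_set_system [set: T] (fun w => X w i 0) measurable.

Definition linear_form (a : 'cV[K]_d) (w : T) : K := (a^T *m X w) 0 0.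

Lemma linear_formE a w : linear_form a w = \sum_i a i 0 * X w i 0.
Proof. by rewrite /linear_form !mxE; apply: eq_bigr => i _; rewrite mxE. Qed.

Lemma linear_formD a b w :
  linear_form (a + b) w = linear_form a w + linear_form b w.
Proof. by rewrite /linear_form linearD mulmxDl mxE. Qed.

Lemma linear_formN a w : linear_form (- a) w = - linear_form a w.
Proof. by rewrite /linear_form linearN mulNmx mxE. Qed.

Lemma linear_formZ c a w : linear_form (c *: a) w = c * linear_form a w.
Proof. by rewrite /linear_form linearZ -scalemxAl mxE. Qed.

Lemma sigma_rvec_measurable :
  (forall i, measurable_fun [set: T] (fun w => X w i 0)) ->
  sigma_rvec X `<=` measurable.
Proof.
move=> mX; apply: smallest_sub; first exact: sigma_algebra_measurable.
move=> A; rewrite big_mkcond; elim/big_ind : _ => // [B C BA CA [/BA//|/CA//]|i _ /=].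
by move=> [B mB <-]; exact: mX.
Qed.

Lemma sigma_rvec_setT : sigma_rvec X setT.
Proof.
have [s0 sC _] : sigma_algebra setT (sigma_rvec X) := smallest_sigma_algebra _ _.
by rewrite -(setD0 setT); exact: sC.
Qed.

(** Measurability for the sigma-algebra generated by [X]: such
    functions are independent of everything that [X] is independent of. *)
Definition measurable_in_vector (f : T -> K) : Prop :=
  measurable_fun (T := g_sigma_algebraType G) [set: T] f.

Lemma sigma_rv_sub_sigma_rvec f :
  measurable_in_vector f -> sigma_rv f `<=` sigma_rvec X.
Proof. by move=> mf _ [B mB <-]; exact: mf. Qed.

Lemma measurable_in_vector_linear_form a :
  measurable_in_vector (linear_form a).
Proof.
rewrite /measurable_in_vector (_ : linear_form a = fun w => \sum_i a i 0 * X w i 0).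
  apply: measurable_sum => i; apply: measurable_funM => // _ B mB.
  apply: sub_sigma_algebra; rewrite /G (bigD1 i)//=; left.
  by exists B.
by apply/funext => w; exact: linear_formE.
Qed.

Lemma measurable_in_vectorM f g :
  measurable_in_vector f -> measurable_in_vector g ->
  measurable_in_vector (fun w => f w * g w).
Proof. exact: measurable_funM. Qed.

Lemma measurable_in_vectorX f n :
  measurable_in_vector f -> measurable_in_vector (fun w => f w ^+ n).
Proof. exact: measurable_funX. Qed.

Lemma measurable_in_vector_sum (I : Type) (r : seq I) (f : I -> T -> K) :
  (forall i, measurable_in_vector (f i)) ->
  measurable_in_vector (fun w => \sum_(i <- r) f i w).
Proof. exact: measurable_sum. Qed.

End RandomVectorSigma.

(** * Gaussian vectors *)

Section NormalLaw.
Context (K : realType) (disp : measure_display) (T : measurableType disp).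
Variable P : probability T K.

Lemma normal_law_integral (Z : T -> K) m s (f : K -> K) u :
  has_normal_law P Z m s -> measurable_fun [set: K] f ->
  has_expectation P (f \o Z) u ->
  (\int[normal_prob m s]_x (f x)%:E = u%:E)%E.
Proof.
move=> [mZ lawZ] mf [fi <-].
pose ZR : {mfun T >-> measurableTypeR K} :=
  HB.pack Z (isMeasurableFun.Build _ _ T (measurableTypeR K) Z mZ).
transitivity (\int[distribution P ZR]_x (f x)%:E)%E.
  by apply: eq_measure_integral => A mA _; exact/esym/lawZ.
rewrite integral_pushforward ?preimage_setT//; exact/measurable_EFinP.
Qed.

Lemma normal_law_ge0_integrable (Z : T -> K) m s (f : K -> K) u :
  has_normal_law P Z m s -> measurable_fun [set: K] f -> (forall x, 0 <= f x) ->
  (\int[normal_prob m s]_x (f x)%:E = u%:E)%E ->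
  has_expectation P (f \o Z) u.
Proof.
move=> [mZ lawZ] mf f0 fu.
pose ZR : {mfun T >-> measurableTypeR K} :=
  HB.pack Z (isMeasurableFun.Build _ _ T (measurableTypeR K) Z mZ).
have E : (\int[P]_w (f (Z w))%:E = u%:E)%E.
  transitivity (\int[distribution P ZR]_x (f x)%:E)%E; last first.
    by rewrite -fu; apply: eq_measure_integral => A mA _; exact: lawZ.
  rewrite ge0_integral_pushforward ?preimage_setT//.
    exact/measurable_EFinP.
  by move=> x _; rewrite lee_fin.
split => //; apply/integrableP; split.
  by apply/measurable_EFinP; exact: measurableT_comp.
under eq_integral do rewrite /= ger0_norm//.
by rewrite E ltry.
Qed.

Lemma normal_law_moment2 (Z : T -> K) s : has_normal_law P Z 0 s -> s != 0 ->
  has_expectation P (fun w => Z w ^+ 2) (s ^+ 2).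
Proof.
move=> lawZ s0; apply: (normal_law_ge0_integrable (f := fun x => x ^+ 2) lawZ).
- exact: measurable_funX.
- by move=> x; rewrite sqr_ge0.
- exact: moment2_normal.
Qed.

Lemma normal_law_moment4 (Z : T -> K) s : has_normal_law P Z 0 s -> s != 0 ->
  has_expectation P (fun w => Z w ^+ 4) (3 * s ^+ 4).
Proof.
move=> lawZ s0; apply: (normal_law_ge0_integrable (f := fun x => x ^+ 4) lawZ).
- exact: measurable_funX.
- by move=> x; rewrite exprn_even_ge0.
- exact: moment4_normal.
Qed.

(** [|z|^k <= 1 + z^4] for [k <= 4]. *)
Lemma has_expectation_exprn_le4 (Z : T -> K) u k : (k <= 4)%N ->
  measurable_fun [set: T] Z -> has_expectation P (fun w => Z w ^+ 4) u ->
  exists v, has_expectation P (fun w => Z w ^+ k) v.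
Proof.
move=> k4 mZ h4; eexists; apply: integrable_has_expectation.
have [i1 _] := has_expectationD (has_expectation_cst P 1) h4.
apply: le_integrable i1 => //.
  by apply/measurable_EFinP; exact: measurable_funX.
move=> w _ /=; rewrite lee_fin normrX [leRHS]ger0_norm; last first.
  by rewrite addr_ge0// exprn_even_ge0.
have -> : Z w ^+ 4 = `|Z w| ^+ 4 by rewrite -normrX ger0_norm ?exprn_even_ge0.
have [z1|z1] := leP `|Z w| 1.
  by apply: (@le_trans _ _ 1); rewrite ?exprn_ile1// lerDl exprn_ge0.
by apply: (@le_trans _ _ (`|Z w| ^+ 4)); rewrite ?lerDr// ler_weXn2l// ltW.
Qed.

End NormalLaw.

Section GaussianVector.
Context (K : realType) (disp : measure_display) (T : measurableType disp).
Variables (P : probability T K) (d : nat) (X : T -> 'cV[K]_d).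
Variable Sigma : 'M[K]_d.
Hypotheses (pd : posdef_mx Sigma) (normalX : mvnormal P X 0 Sigma).

Definition cov (a b : 'cV[K]_d) : K := (a^T *m Sigma *m b) 0 0.

Lemma covC a b : cov a b = cov b a.
Proof.
rewrite /cov -[in LHS](trmxK (a^T *m Sigma *m b)) mxE.
by rewrite !trmx_mul trmxK mulmxA pd.1.
Qed.

Lemma covDr a b c : cov a (b + c) = cov a b + cov a c.
Proof. by rewrite /cov mulmxDr mxE. Qed.

Lemma covDl a b c : cov (a + b) c = cov a c + cov b c.
Proof. by rewrite covC covDr !(covC c). Qed.

Lemma covNr a b : cov a (- b) = - cov a b.
Proof. by rewrite /cov mulmxN mxE. Qed.

Lemma covNl a b : cov (- a) b = - cov a b.
Proof. by rewrite covC covNr covC. Qed.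

Lemma covZr k a b : cov a (k *: b) = k * cov a b.
Proof. by rewrite /cov -scalemxAr mxE. Qed.

Lemma covZl k a b : cov (k *: a) b = k * cov a b.
Proof. by rewrite covC covZr covC. Qed.

Lemma cov_combination k l a b : cov (k *: a + l *: b) (k *: a + l *: b) =
  k ^+ 2 * cov a a + 2 * k * l * cov a b + l ^+ 2 * cov b b.
Proof. by rewrite !(covDl, covDr, covZl, covZr) (covC b a); ring. Qed.

Lemma cov_gt0 a : a != 0 -> 0 < cov a a.
Proof. exact: pd.2. Qed.

Local Notation L := (linear_form X).

Lemma linear_form_normal a : a != 0 ->
  has_normal_law P (L a) 0 (Num.sqrt (cov a a)).
Proof. by move=> /normalX.2; rewrite mulmx0 mxE. Qed.

Lemma linear_form0 w : L 0 w = 0.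
Proof. by rewrite /linear_form trmx0 mul0mx mxE. Qed.

Lemma gaussian_moment2 a : has_expectation P (fun w => L a w ^+ 2) (cov a a).
Proof.
have [->|a0] := eqVneq a 0.
  apply: has_expectation_eq (has_expectation_cst P 0) _ _ => [w|].
    by rewrite linear_form0 expr0n.
  by rewrite /cov mulmx0 mxE.
have := normal_law_moment2 (linear_form_normal a0).
by rewrite sqr_sqrtr ?(ltW (cov_gt0 a0))//; apply; rewrite gt_eqF// sqrtr_gt0 cov_gt0.
Qed.

Lemma gaussian_moment4 a :
  has_expectation P (fun w => L a w ^+ 4) (3 * cov a a ^+ 2).
Proof.
have [->|a0] := eqVneq a 0.
  apply: has_expectation_eq (has_expectation_cst P 0) _ _ => [w|].
    by rewrite linear_form0 expr0n.
  by rewrite /cov mulmx0 mxE expr0n /= mulr0.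
have := normal_law_moment4 (linear_form_normal a0).
rewrite (_ : 4 = 2 * 2)%N// exprM sqr_sqrtr ?(ltW (cov_gt0 a0))//.
by apply; rewrite gt_eqF// sqrtr_gt0 cov_gt0.
Qed.

Lemma measurable_linear_form a : measurable_fun [set: T] (L a).
Proof.
have [->|a0] := eqVneq a 0; last exact: (linear_form_normal a0).1.
by rewrite (_ : L 0 = cst 0)//; apply/funext => w; exact: linear_form0.
Qed.

(** [- a^T X] is again the linear form of a normal vector and has the same law
    as [a^T X], so that an odd moment is its own opposite. *)
Lemma gaussian_odd_moment a k : odd k -> (k <= 4)%N ->
  has_expectation P (fun w => L a w ^+ k) 0.
Proof.
move=> ok k4; have [->|a0] := eqVneq a 0.
  apply: has_expectation_eq (has_expectation_cst P 0) _ _ => [w|//].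
  by rewrite linear_form0 expr0n; case: k ok {k4}.
have [v hv] := has_expectation_exprn_le4 k4 (measurable_linear_form a)
  (gaussian_moment4 a).
have hv' : has_expectation P (fun w => L (- a) w ^+ k) (- v).
  apply: has_expectation_eq (has_expectationZ (-1) hv) _ _ => [w|].
    by rewrite linear_formN exprNn -signr_odd ok expr1.
  by rewrite mulN1r.
have mk : measurable_fun [set: K] (fun x : K => x ^+ k) by exact: measurable_funX.
have lawN : has_normal_law P (L (- a)) 0 (Num.sqrt (cov a a)).
  have := @linear_form_normal (- a); rewrite oppr_eq0 covNl covNr opprK; exact.
have := normal_law_integral (linear_form_normal a0) mk hv.
rewrite (normal_law_integral lawN mk hv') => -[vN].
by have <- : v = 0 by lra.
Qed.

End GaussianVector.

(** * Mixed Gaussian moments *)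

Section Polarization.
Context (K : realType) (disp : measure_display) (T : measurableType disp).
Variable P : probability T K.
Local Notation has := (has_expectation P).

Lemma has_expectation_polar2 (x y : T -> K) v1 v2 :
  has (fun w => (x w + y w) ^+ 2) v1 -> has (fun w => (x w - y w) ^+ 2) v2 ->
  has (fun w => x w * y w) (4^-1 * (v1 - v2)).
Proof.
move=> h1 h2.
apply: has_expectation_eq
  (has_expectationZ 4^-1 (has_expectationD h1 (has_expectationZ (-1) h2))) _ _.
  by move=> w; field.
by rewrite mulN1r.
Qed.

(** A product of [n] variables is a signed combination of the [n]-th powers of
    their sums with all choices of signs after the first term. *)
Lemma has_expectation_polar3 (x y z : T -> K) v1 v2 v3 v4 :
  has (fun w => (x w + y w + z w) ^+ 3) v1 ->
  has (fun w => (x w + y w - z w) ^+ 3) v2 ->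
  has (fun w => (x w - y w + z w) ^+ 3) v3 ->
  has (fun w => (x w - y w - z w) ^+ 3) v4 ->
  has (fun w => x w * y w * z w) (24^-1 * (v1 - v2 - v3 + v4)).
Proof.
move=> h1 h2 h3 h4.
apply: has_expectation_eq (has_expectationZ 24^-1
  (has_expectationD (has_expectationD h1 (has_expectationZ (-1) h2))
    (has_expectationD (has_expectationZ (-1) h3) h4))) _ _.
  by move=> w; field.
by field.
Qed.

Lemma has_expectation_polar4 (x y z t : T -> K) v1 v2 v3 v4 v5 v6 v7 v8 :
  has (fun w => (x w + y w + z w + t w) ^+ 4) v1 ->
  has (fun w => (x w + y w - z w - t w) ^+ 4) v2 ->
  has (fun w => (x w - y w + z w - t w) ^+ 4) v3 ->
  has (fun w => (x w - y w - z w + t w) ^+ 4) v4 ->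
  has (fun w => (x w + y w + z w - t w) ^+ 4) v5 ->
  has (fun w => (x w + y w - z w + t w) ^+ 4) v6 ->
  has (fun w => (x w - y w + z w + t w) ^+ 4) v7 ->
  has (fun w => (x w - y w - z w - t w) ^+ 4) v8 ->
  has (fun w => x w * y w * z w * t w)
    (192^-1 * (v1 + v2 + v3 + v4 - (v5 + v6 + v7 + v8))).
Proof.
move=> h1 h2 h3 h4 h5 h6 h7 h8.
apply: has_expectation_eq (has_expectationZ 192^-1
  (has_expectationD
    (has_expectationD (has_expectationD h1 h2) (has_expectationD h3 h4))
    (has_expectationZ (-1)
      (has_expectationD (has_expectationD h5 h6) (has_expectationD h7 h8))))) _ _.
  by move=> w; field.
by field.
Qed.

End Polarization.

Section GaussianTensors.
Context (K : realType) (disp : measure_display) (T : measurableType disp).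
Variables (P : probability T K) (d : nat) (X : T -> 'cV[K]_d).
Variable Sigma : 'M[K]_d.
Hypotheses (pd : posdef_mx Sigma) (normalX : mvnormal P X 0 Sigma).
Local Notation L := (linear_form X).
Local Notation C := (cov Sigma).
Local Notation has := (has_expectation P).

Lemma gaussian_pair a b : has (fun w => L a w * L b w) (C a b).
Proof.
have h1 := gaussian_moment2 pd normalX (a + b).
have h2 := gaussian_moment2 pd normalX (a - b).
apply: has_expectation_eq (has_expectation_polar2 (x := L a) (y := L b)
    (has_expectation_eq h1 _ erefl) (has_expectation_eq h2 _ erefl)) _ _ => //.
- by move=> w; rewrite linear_formD.
- by move=> w; rewrite linear_formD linear_formN.
- by rewrite !(covDl pd, covDr, covNl pd, covNr) (covC pd b a); field.
Qed.

Lemma gaussian_triple a b c : has (fun w => L a w * L b w * L c w) 0.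
Proof.
have h v := gaussian_odd_moment pd normalX v (isT : odd 3) (isT : 3 <= 4)%N.
apply: has_expectation_eq
  (has_expectation_polar3 (x := L a) (y := L b) (z := L c)
    (has_expectation_eq (h (a + b + c)) _ erefl)
    (has_expectation_eq (h (a + b - c)) _ erefl)
    (has_expectation_eq (h (a - b + c)) _ erefl)
    (has_expectation_eq (h (a - b - c)) _ erefl)) _ _ => //;
  try by move=> w; rewrite !(linear_formD, linear_formN).
by rewrite !subr0 addr0 mulr0.
Qed.

(** Isserlis' formula of order four. *)
Lemma gaussian_quadruple a b c f :
  has (fun w => L a w * L b w * L c w * L f w)
    (C a b * C c f + C a c * C b f + C a f * C b c).
Proof.
have h v := gaussian_moment4 pd normalX v.
apply: has_expectation_eq
  (has_expectation_polar4 (x := L a) (y := L b) (z := L c) (t := L f)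
    (has_expectation_eq (h (a + b + c + f)) _ erefl)
    (has_expectation_eq (h (a + b - c - f)) _ erefl)
    (has_expectation_eq (h (a - b + c - f)) _ erefl)
    (has_expectation_eq (h (a - b - c + f)) _ erefl)
    (has_expectation_eq (h (a + b + c - f)) _ erefl)
    (has_expectation_eq (h (a + b - c + f)) _ erefl)
    (has_expectation_eq (h (a - b + c + f)) _ erefl)
    (has_expectation_eq (h (a - b - c - f)) _ erefl)) _ _ => //;
  try by move=> w; rewrite !(linear_formD, linear_formN).
rewrite !(covDl pd, covDr, covNl pd, covNr).
rewrite (covC pd b a) (covC pd c a) (covC pd f a) (covC pd c b) (covC pd f b).
by rewrite (covC pd f c); field.
Qed.

Variable Q : 'M[K]_d.
Hypotheses (Qsym : Q^T = Q) (QSQ : Q *m Sigma *m Q = Q).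
Local Notation e i := (delta_mx i 0 : 'cV[K]_d).

Definition quadratic_form (w : T) : K := ((X w)^T *m Q *m X w) 0 0.
Local Notation q := quadratic_form.

(** Both factors on the right are linear forms, so that moments of [q] are
    double sums of mixed Gaussian moments. *)
Lemma quadratic_formE w : q w = \sum_i L (e i) w * L (Q *m (e i)) w.
Proof.
rewrite /quadratic_form -mulmxA mxE; apply: eq_bigr => i _.
rewrite mxE /linear_form; congr (_ * _).
  by rewrite trmx_delta -rowE mxE.
by rewrite trmx_mul Qsym trmx_delta -mulmxA -rowE !mxE.
Qed.

Lemma measurable_in_quadratic_form : measurable_in_vector X q.
Proof.
rewrite (_ : q = fun w => \sum_i L (e i) w * L (Q *m (e i)) w); last first.
  by apply/funext => w; exact: quadratic_formE.
apply: measurable_in_vector_sum => i.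
by apply: measurable_in_vectorM; exact: measurable_in_vector_linear_form.
Qed.

Lemma cov_delta i j : C (e i) (e j) = Sigma i j.
Proof. by rewrite /cov trmx_delta -rowE -colE !mxE. Qed.

Lemma cov_deltaQ i j : C (e i) (Q *m (e j)) = (Sigma *m Q) i j.
Proof. by rewrite /cov trmx_delta -rowE mulmxA -row_mul -colE !mxE. Qed.

Lemma cov_deltaQQ i j : C (Q *m (e i)) (Q *m (e j)) = Q i j.
Proof.
rewrite /cov trmx_mul Qsym trmx_delta -!mulmxA (mulmxA Sigma) (mulmxA Q).
by rewrite (mulmxA Q) QSQ -rowE -colE !mxE.
Qed.

Local Notation r := (\tr (Sigma *m Q)).

Lemma quadratic_form_mean : has q r.
Proof.
apply: has_expectation_eq (has_expectation_sum _
  (fun i => gaussian_pair (e i) (Q *m (e i)))) _ _ => [w|].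
  by rewrite quadratic_formE.
by apply: eq_bigr => i _; exact: cov_deltaQ.
Qed.

Lemma quadratic_form_linear a : has (fun w => q w * L a w) 0.
Proof.
apply: has_expectation_eq (has_expectation_sum _
  (fun i => gaussian_triple (e i) (Q *m (e i)) a)) _ _ => [w|].
  by rewrite quadratic_formE mulr_suml.
by rewrite big1.
Qed.

(** [Q Sigma a = 0] says that [a^T X] is uncorrelated with [Q X]; the cross terms
    of Isserlis' formula vanish. *)
Lemma quadratic_form_square_linear a : Q *m Sigma *m a = 0 ->
  has (fun w => q w * L a w ^+ 2) (r * C a a).
Proof.
move=> Qa0; apply: has_expectation_eq (has_expectation_sum _
  (fun i => gaussian_quadruple (e i) (Q *m (e i)) a a)) _ _ => [w|].
  rewrite quadratic_formE mulr_suml; apply: eq_bigr => i _.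
  by rewrite expr2 !mulrA.
rewrite mulr_suml; apply: eq_bigr => i _.
have -> : C (Q *m (e i)) a = 0.
  by rewrite /cov trmx_mul Qsym -!mulmxA (mulmxA Q) Qa0 mulmx0 mxE.
by rewrite !mulr0 !addr0 cov_deltaQ.
Qed.

(** Because [Q Sigma Q = Q], this is the second moment of a chi-square variable
    with [r] degrees of freedom. *)
Lemma quadratic_form_square : has (fun w => q w ^+ 2) (r ^+ 2 + 2 * r).
Proof.
apply: has_expectation_eq (has_expectation_sum _ (fun i =>
   has_expectation_sum _ (fun j =>
     gaussian_quadruple (e i) (Q *m (e i)) (e j) (Q *m (e j))))) _ _ => [w|].
  rewrite expr2 !quadratic_formE big_distrlr /=.
  by apply: eq_bigr => i _; apply: eq_bigr => j _; rewrite !mulrA.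
have E i j : C (e i) (Q *m (e i)) * C (e j) (Q *m (e j)) +
    C (e i) (e j) * C (Q *m (e i)) (Q *m (e j)) +
    C (e i) (Q *m (e j)) * C (Q *m (e i)) (e j) =
  (Sigma *m Q) i i * (Sigma *m Q) j j + (Sigma i j * Q j i +
    (Sigma *m Q) i j * (Sigma *m Q) j i).
  rewrite (covC pd (Q *m (e i)) (e j)) !cov_deltaQ cov_delta cov_deltaQQ -addrA.
  by rewrite (_ : Q i j = Q j i)// -{1}Qsym mxE.
under eq_bigr do under eq_bigr do rewrite E.
have trE (A B : 'M[K]_d) : \sum_i \sum_j A i j * B j i = \tr (A *m B).
  by apply: eq_bigr => i _; rewrite mxE.
under eq_bigr do rewrite big_split /= big_split /=.
rewrite !big_split /= !trE -big_distrlr /= mulmxA -(mulmxA Sigma Q) -(mulmxA Sigma).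
by rewrite QSQ expr2 mulr_natl mulr2n.
Qed.

End GaussianTensors.

(** * Splitting the precision matrix along gamma *)

Section PositiveDefinite.
Context (K : realType) (d : nat) (Sigma : 'M[K]_d) (gamma : 'cV[K]_d).
Hypotheses (pd : posdef_mx Sigma) (gamma0 : gamma != 0).

Lemma posdef_unitmx : Sigma \in unitmx.
Proof.
rewrite unitmxE unitfE; apply/negP => /det0P[v v0 vS].
have := pd.2 v^T; rewrite -(inj_eq (@trmx_inj _ _ _)) trmxK trmx0 v0 => /(_ isT).
by rewrite vS mul0mx mxE ltxx.
Qed.

Lemma invmx_posdef_sym : (invmx Sigma)^T = invmx Sigma.
Proof. by rewrite trmx_inv pd.1. Qed.

Local Notation alpha := (Num.sqrt ((gamma^T *m invmx Sigma *m gamma) 0 0)).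

(** The covector [t] for which [t^T X] is the normalized component [T0] of [X]
    in the direction of [gamma]. *)
Definition unit_direction : 'cV[K]_d := alpha^-1 *: (invmx Sigma *m gamma).
Local Notation t := unit_direction.

(** The part of [Sigma^-1] that sees only the directions orthogonal to [gamma]
    for the inner product defined by [Sigma^-1]. *)
Definition residual_mx : 'M[K]_d := invmx Sigma - t *m t^T.
Local Notation Q := residual_mx.

Lemma alpha_gt0 : 0 < alpha.
Proof.
rewrite sqrtr_gt0; have := pd.2 (invmx Sigma *m gamma).
rewrite trmx_mul invmx_posdef_sym -!mulmxA mulKVmx ?posdef_unitmx//; apply.
by apply: contra gamma0 => /eqP g0; rewrite -(mulKVmx posdef_unitmx gamma) g0 mulmx0.
Qed.

Lemma unit_direction_form (X : 'cV[K]_d) :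
  (t^T *m X) 0 0 = alpha^-1 * (gamma^T *m invmx Sigma *m X) 0 0.
Proof.
by rewrite /t linearZ /= trmx_mul invmx_posdef_sym -scalemxAl mxE.
Qed.

Lemma Sigma_unit_direction : Sigma *m t = alpha^-1 *: gamma.
Proof. by rewrite /t -scalemxAr mulKVmx// posdef_unitmx. Qed.

Lemma unit_direction_gamma : (t^T *m gamma) 0 0 = alpha.
Proof.
rewrite unit_direction_form -[X in _ * X]sqr_sqrtr ?expr2 ?mulKf ?gt_eqF ?alpha_gt0//.
by have := alpha_gt0; rewrite sqrtr_gt0 => /ltW.
Qed.

Lemma cov_unit_direction : cov Sigma t t = 1.
Proof.
rewrite /cov -mulmxA Sigma_unit_direction -scalemxAr mxE unit_direction_gamma.
by rewrite mulVf// gt_eqF// alpha_gt0.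
Qed.

Lemma scalar_unit_direction : t^T *m Sigma *m t = 1%:M.
Proof. by rewrite [LHS]mx11_scalar; congr _%:M; exact: cov_unit_direction. Qed.

Lemma residual_mx_sym : Q^T = Q.
Proof. by rewrite /Q linearB /= invmx_posdef_sym trmx_mul trmxK. Qed.

Lemma residual_mx_unit_direction : Q *m Sigma *m t = 0.
Proof.
rewrite /Q !mulmxBl mulVmx ?posdef_unitmx// mul1mx -!mulmxA (mulmxA _ Sigma).
by rewrite scalar_unit_direction mulmx1 subrr.
Qed.

Lemma residual_mx_gamma : Q *m gamma = 0.
Proof.
have := residual_mx_unit_direction; rewrite -mulmxA Sigma_unit_direction.
rewrite -scalemxAr => /eqP; rewrite scaler_eq0 invr_eq0 gt_eqF ?alpha_gt0//=.
by move/eqP.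
Qed.

Lemma residual_mx_idem : Q *m Sigma *m Q = Q.
Proof.
rewrite {2}/Q mulmxBr -(mulmxA Q Sigma) mulmxV ?posdef_unitmx// mulmx1 mulmxA.
by rewrite residual_mx_unit_direction mul0mx subr0.
Qed.

Lemma Sigma_residual_mx : Sigma *m Q = 1%:M - Sigma *m t *m t^T.
Proof. by rewrite /Q mulmxBr mulmxV ?posdef_unitmx// mulmxA. Qed.

Lemma trace_residual_mx : \tr (Sigma *m Q) = d%:R - 1.
Proof.
rewrite Sigma_residual_mx linearB /= mxtrace1 mxtrace_mulC mulmxA.
by rewrite scalar_unit_direction mxtrace1.
Qed.

(** Sherman--Morrison: relative to [Sigma], the matrix has weight [c] on the
    residual directions and [c + alpha^2 m] along [gamma]; the inverse carries
    the reciprocal weights on [Q] and on [t t^T]. *)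
Lemma rank_one_update_inverse (m c : K) : c != 0 -> c + alpha ^+ 2 * m != 0 ->
  invmx (m *: (gamma *m gamma^T) + c *: Sigma) =
  c^-1 *: (Q + (c / (c + alpha ^+ 2 * m)) *: (t *m t^T)).
Proof.
move=> c0 cm0; set V := _ + _; set M := RHS.
have gE : gamma = alpha *: (Sigma *m t).
  by rewrite Sigma_unit_direction scalerA divff ?scale1r// gt_eqF// alpha_gt0.
suff VM : V *m M = 1%:M.
  have Vu : V \in unitmx by have [] := mulmx1_unit VM.
  by rewrite -[LHS]mulmx1 -VM mulKmx.
have gQ : gamma^T *m Q = 0.
  by apply: trmx_inj; rewrite trmx_mul trmxK residual_mx_sym residual_mx_gamma trmx0.
have gt : gamma^T *m t = alpha%:M.
  rewrite [LHS]mx11_scalar; congr _%:M.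
  by rewrite -unit_direction_gamma -[gamma^T *m t]trmxK trmx_mul trmxK mxE.
pose A := Sigma *m t *m t^T.
have gtA : gamma *m gamma^T *m (t *m t^T) = alpha ^+ 2 *: A.
  rewrite -mulmxA (mulmxA gamma^T) gt mul_scalar_mx -scalemxAr [X in X *m t^T]gE.
  by rewrite -scalemxAl scalerA expr2.
have gQ0 : gamma *m gamma^T *m Q = 0 by rewrite -mulmxA gQ mulmx0.
have StA : Sigma *m (t *m t^T) = A by rewrite mulmxA.
rewrite /V /M; set k := c / _.
rewrite -scalemxAr mulmxDl mulmxDr [X in _ + X]mulmxDr.
rewrite -[m *: _ *m Q]scalemxAl gQ0 scaler0 add0r.
rewrite -[c *: _ *m Q]scalemxAl Sigma_residual_mx -/A.
rewrite -!(scalemxAr k) -(scalemxAl m) -(scalemxAl c) gtA StA !scalerA addrCA.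
rewrite -scalerDl scalerBr.
rewrite -addrA -scaleNr -scalerDl scalerDr !scalerA mulVf// scale1r.
rewrite [X in _ + X *: _](_ : _ = 0) ?scale0r ?addr0//.
by rewrite /k; field; rewrite c0 cm0.
Qed.

End PositiveDefinite.

(** * Moments of the mixture *)

Section MixtureIndependence.
Context (K : realType) (disp : measure_display) (T : measurableType disp).
Variables (P : probability T K) (d : nat) (xi gamma : 'cV[K]_d).
Variables (Sigma : 'M[K]_d) (H : probability (K * K)%type K).
Variables (X : T -> 'cV[K]_d) (R S : T -> K) (Y : T -> 'cV[K]_d).
Hypothesis hY : GMN P xi Sigma gamma H X R S Y.

Lemma gmn_independent :
  independent2 P (sigma_rvec X) (sigma_rv (fun w => (R w, S w))).
Proof.
have [U [V [r [s [ind _ RE SE]]]]] := gmn_mixing hY.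
have indUV := independent3_pair
  (sigma_rvec_measurable (gmn_normal hY).1) (sigma_rvec_setT (X := X)) ind.
apply: independent2_subset indUV => //.
rewrite (_ : (fun w => (R w, S w)) =
    (fun uv => (r uv, s uv)) \o (fun w => (U w, V w))).
  by apply: preimage_set_system_compS; exact: measurable_fun_pair.
by apply/funext => w /=; rewrite RE SE.
Qed.

Lemma gmn_scale_gt0 w : 0 < S w.
Proof. by have [U [V [r [s [_ s0 _ ->]]]]] := gmn_mixing hY; exact: s0. Qed.

Lemma mixing_expectationM (g : K * K -> K) f u v :
  measurable_fun [set: K * K] g -> measurable_in_vector X f ->
  has_expectation P (fun w => g (R w, S w)) u -> has_expectation P f v ->
  has_expectation P (fun w => g (R w, S w) * f w) (u * v).
Proof.
move=> mg mf hg hf.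
apply: has_expectation_eq (has_expectationM _ hf hg) _ _ => [|w|].
- apply: independent2_subset gmn_independent.
    exact: sigma_rv_sub_sigma_rvec.
  exact: (preimage_set_system_compS (f := fun w => (R w, S w)) (g := g)).
- by rewrite mulrC.
- by rewrite mulrC.
Qed.

End MixtureIndependence.

Section MixtureMoments.
Context (K : realType) (disp : measure_display) (T : measurableType disp).
Variables (P : probability T K) (d : nat) (xi gamma : 'cV[K]_d).
Variables (Sigma : 'M[K]_d) (H : probability (K * K)%type K).
Variables (X : T -> 'cV[K]_d) (R S : T -> K) (Y : T -> 'cV[K]_d).
Hypothesis hY : GMN P xi Sigma gamma H X R S Y.
Hypothesis hmom : forall h k : nat, (h + k <= 4)%N ->
  P.-integrable [set: T] (fun w => (R w ^+ h * S w ^+ k)%:E).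
Local Notation mu := (joint_moment P R S).
Local Notation has := (has_expectation P).
Local Notation L := (linear_form X).
Local Notation C := (cov Sigma).
Let pd := gmn_posdef hY.
Let normalX := gmn_normal hY.

Lemma has_joint_moment h k : (h + k <= 4)%N ->
  has (fun w => R w ^+ h * S w ^+ k) (mu h k).
Proof. by move=> hk; exact/integrable_has_expectation/hmom. Qed.

Lemma joint_moment00 : mu 0 0 = 1.
Proof.
apply: (@has_expectation_unique _ _ _ P (fun=> 1)).
  by apply: has_expectation_eq (@has_joint_moment 0 0 isT) _ _ => // w; rewrite mulr1.
exact: has_expectation_cst.
Qed.

(** [E((R - mu10)^h S^k)], in expanded form. *)
Definition centered_moment (h k : nat) : K :=
  \sum_(i < h.+1) ((- mu 1 0) ^+ i *+ 'C(h, i)) * mu (h - i) k.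
Local Notation cm := centered_moment.
Local Notation R0 w := (R w - mu 1 0).

Lemma has_centered_moment h k : (h + k <= 4)%N ->
  has (fun w => R0 w ^+ h * S w ^+ k) (cm h k).
Proof.
move=> hk; have hi (i : 'I_h.+1) : (h - i + k <= 4)%N.
  by rewrite (leq_trans _ hk)// leq_add2r leq_subr.
have hs (i : 'I_h.+1) := has_expectationZ ((- mu 1 0) ^+ i *+ 'C(h, i))
  (has_joint_moment (hi i)).
apply: has_expectation_eq (has_expectation_sum (index_enum _) hs) _ _ => //.
move=> w; rewrite exprDn mulr_suml; apply: eq_bigr => i _.
by rewrite mulrA; congr (_ * _); rewrite mulrC -mulrnAr.
Qed.

Lemma centered_momentE :
  [/\ cm 1 0 = 0, cm 2 0 = mu 2 0 - mu 1 0 ^+ 2,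
      cm 3 0 = mu 3 0 - 3 * mu 2 0 * mu 1 0 + 2 * mu 1 0 ^+ 3 &
      cm 4 0 = mu 4 0 - 4 * mu 3 0 * mu 1 0 + 6 * mu 2 0 * mu 1 0 ^+ 2
                   - 3 * mu 1 0 ^+ 4] /\
  [/\ cm 0 2 = mu 0 2, cm 0 4 = mu 0 4, cm 1 2 = mu 1 2 - mu 1 0 * mu 0 2 &
      cm 2 2 = mu 2 2 - 2 * mu 1 2 * mu 1 0 + mu 1 0 ^+ 2 * mu 0 2].
Proof.
rewrite /cm; rewrite !big_ord_recl !big_ord0 /= /bump /=.
rewrite !bin0 !bin1 !binn (_ : 'C(3, 1 + 1) = 3)%N// (_ : 'C(4, 1 + 1) = 6)%N//.
rewrite (_ : 'C(4, 1 + (1 + 1)) = 4)%N// !subn0 !subnn.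
rewrite (_ : 2 - 1 = 1)%N// (_ : 3 - 1 = 2)%N// (_ : 3 - (1 + 1) = 1)%N//.
rewrite (_ : 4 - 1 = 3)%N// (_ : 4 - (1 + 1) = 2)%N//.
rewrite (_ : 4 - (1 + (1 + 1)) = 1)%N// joint_moment00.
by split; split; ring.
Qed.

(** The source of all expectations below: [X] and [(R, S)] are independent, so
    the expectation factors. *)
Lemma has_mixture h k f v : (h + k <= 4)%N -> measurable_in_vector X f ->
  has f v -> has (fun w => R0 w ^+ h * S w ^+ k * f w) (cm h k * v).
Proof.
move=> hk mf hf.
pose g (p : K * K) : K := (p.1 - mu 1 0) ^+ h * p.2 ^+ k.
apply: (mixing_expectationM hY (g := g)) => //; last exact: has_centered_moment.
by apply: measurable_funM; apply: measurable_funX => //; exact: measurable_funB.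
Qed.

(** With [p = a^T gamma] this is [a^T (Y - E Y)] (see [form_centered]); a free
    [p] keeps the family stable under sums without mentioning [gamma]. *)
Definition mixture_form (p : K) (a : 'cV[K]_d) (w : T) : K :=
  p * R0 w + S w * L a w.
Local Notation Z := mixture_form.

Let mL a := measurable_in_vector_linear_form (X := X) a.
Let mL2 a := measurable_in_vectorX 2 (mL a).
Let mL3 a := measurable_in_vectorX 3 (mL a).
Let mL4 a := measurable_in_vectorX 4 (mL a).
Let m1 : measurable_in_vector X (fun=> 1).
Proof. exact: measurable_cst. Qed.

Let E1 := has_expectation_cst P 1.
Let EL a : has (L a) 0.
Proof. exact: (gaussian_odd_moment pd normalX a (k := 1)). Qed.
Let EL2 a := gaussian_moment2 pd normalX a.
Let EL3 a := gaussian_odd_moment pd normalX a (isT : odd 3) (isT : 3 <= 4)%N.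
Let EL4 a := gaussian_moment4 pd normalX a.

Lemma mixture_form_mean p a : has (Z p a) 0.
Proof.
apply: has_expectation_eq (has_expectationD
  (has_expectationZ p (@has_mixture 1 0 _ _ isT m1 E1))
  (@has_mixture 0 1 _ _ isT (mL a) (EL a))) _ _.
  by move=> w; rewrite /Z; ring.
by have [[-> _ _ _] _] := centered_momentE; ring.
Qed.

Lemma mixture_form_moment2 p a :
  has (fun w => Z p a w ^+ 2) (p ^+ 2 * cm 2 0 + cm 0 2 * C a a).
Proof.
apply: has_expectation_eq (has_expectationD (has_expectationD
  (has_expectationZ (p ^+ 2) (@has_mixture 2 0 _ _ isT m1 E1))
  (has_expectationZ (2 * p) (@has_mixture 1 1 _ _ isT (mL a) (EL a))))
  (@has_mixture 0 2 _ _ isT (mL2 a) (EL2 a))) _ _.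
  by move=> w; rewrite /Z; ring.
ring.
Qed.

Lemma mixture_form_moment3 p a :
  has (fun w => Z p a w ^+ 3) (p ^+ 3 * cm 3 0 + 3 * p * cm 1 2 * C a a).
Proof.
apply: has_expectation_eq (has_expectationD (has_expectationD
  (has_expectationZ (p ^+ 3) (@has_mixture 3 0 _ _ isT m1 E1))
  (has_expectationZ (3 * p ^+ 2) (@has_mixture 2 1 _ _ isT (mL a) (EL a))))
  (has_expectationD
  (has_expectationZ (3 * p) (@has_mixture 1 2 _ _ isT (mL2 a) (EL2 a)))
  (@has_mixture 0 3 _ _ isT (mL3 a) (EL3 a)))) _ _.
  by move=> w; rewrite /Z; ring.
ring.
Qed.

Lemma mixture_form_moment4 p a :
  has (fun w => Z p a w ^+ 4)
    (p ^+ 4 * cm 4 0 + 6 * p ^+ 2 * cm 2 2 * C a a + 3 * cm 0 4 * C a a ^+ 2).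
Proof.
apply: has_expectation_eq (has_expectationD (has_expectationD
  (has_expectationZ (p ^+ 4) (@has_mixture 4 0 _ _ isT m1 E1))
  (has_expectationZ (4 * p ^+ 3) (@has_mixture 3 1 _ _ isT (mL a) (EL a))))
  (has_expectationD (has_expectationD
  (has_expectationZ (6 * p ^+ 2) (@has_mixture 2 2 _ _ isT (mL2 a) (EL2 a)))
  (has_expectationZ (4 * p) (@has_mixture 1 3 _ _ isT (mL3 a) (EL3 a))))
  (@has_mixture 0 4 _ _ isT (mL4 a) (EL4 a)))) _ _.
  by move=> w; rewrite /Z; ring.
ring.
Qed.

(** The weight [f] will be either the constant 1 or the quadratic form of the
    residual matrix; the hypotheses say that it is uncorrelated with [a^T X],
    and below also with its square. *)
Lemma mixture_form_S2 p a f v : measurable_in_vector X f -> has f v ->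
  has (fun w => f w * L a w) 0 ->
  has (fun w => S w ^+ 2 * Z p a w * f w) (p * cm 1 2 * v).
Proof.
move=> mf hf hfL.
apply: has_expectation_eq (has_expectationD
  (has_expectationZ p (@has_mixture 1 2 _ _ isT mf hf))
  (@has_mixture 0 3 _ _ isT (measurable_in_vectorM mf (mL a)) hfL)) _ _.
  by move=> w; rewrite /Z; ring.
ring.
Qed.

Lemma mixture_form_S2sqr p a f v : measurable_in_vector X f -> has f v ->
  has (fun w => f w * L a w) 0 ->
  has (fun w => f w * L a w ^+ 2) (v * C a a) ->
  has (fun w => S w ^+ 2 * Z p a w ^+ 2 * f w)
    ((p ^+ 2 * cm 2 2 + cm 0 4 * C a a) * v).
Proof.
move=> mf hf hfL hfL2.
apply: has_expectation_eq (has_expectationD (has_expectationD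
  (has_expectationZ (p ^+ 2) (@has_mixture 2 2 _ _ isT mf hf))
  (has_expectationZ (2 * p)
    (@has_mixture 1 3 _ _ isT (measurable_in_vectorM mf (mL a)) hfL)))
  (@has_mixture 0 4 _ _ isT (measurable_in_vectorM mf (mL2 a)) hfL2)) _ _.
  by move=> w; rewrite /Z; ring.
ring.
Qed.

Lemma mixture_formD p q a b w :
  Z (p + q) (a + b) w = Z p a w + Z q b w.
Proof. by rewrite /Z linear_formD; ring. Qed.

Lemma mixture_formN p a w : Z (- p) (- a) w = - Z p a w.
Proof. by rewrite /Z linear_formN; ring. Qed.

Lemma mixture_form_pair p q a b :
  has (fun w => Z p a w * Z q b w) (p * q * cm 2 0 + cm 0 2 * C a b).
Proof.
apply: has_expectation_eq (has_expectation_polar2 (x := Z p a) (y := Z q b)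
    (has_expectation_eq (mixture_form_moment2 (p + q) (a + b)) _ erefl)
    (has_expectation_eq (mixture_form_moment2 (p - q) (a - b)) _ erefl)) _ _ => //;
  try by move=> w; rewrite !(mixture_formD, mixture_formN).
by rewrite !(covDl pd, covDr, covNl pd, covNr) (covC pd b a); field.
Qed.

(** Only the existence of this expectation matters: it provides the
    integrability needed for Fubini's theorem. *)
Lemma mixture_form_triple p q s a b c :
  exists v, has (fun w => Z p a w * Z q b w * Z s c w) v.
Proof.
eexists; apply: (has_expectation_polar3 (x := Z p a) (y := Z q b) (z := Z s c)
  (has_expectation_eq (mixture_form_moment3 (p + q + s) (a + b + c)) _ erefl)
  (has_expectation_eq (mixture_form_moment3 (p + q - s) (a + b - c)) _ erefl)
  (has_expectation_eq (mixture_form_moment3 (p - q + s) (a - b + c)) _ erefl)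
  (has_expectation_eq (mixture_form_moment3 (p - q - s) (a - b - c)) _ erefl));
  by move=> w; rewrite !(mixture_formD, mixture_formN).
Qed.

End MixtureMoments.

(** * The precision matrix of the mixture *)

Section Positivity.
Context (K : realType) (disp : measure_display) (T : measurableType disp).
Variable P : probability T K.

Lemma has_expectation_ge0 f u : has_expectation P f u ->
  (forall w, 0 <= f w) -> 0 <= u.
Proof.
by move=> [_ fu] f0; rewrite -lee_fin -fu; apply: integral_ge0 => w _; rewrite lee_fin.
Qed.

Lemma has_expectation_gt0 f u : has_expectation P f u ->
  (forall w, 0 < f w) -> 0 < u.
Proof.
move=> hf f0; rewrite lt_neqAle (has_expectation_ge0 hf) ?andbT; last first.
  by move=> w; exact/ltW.
apply/negP => /eqP u0; have [fi fu] := hf; rewrite -u0 in fu.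
have mf : measurable_fun [set: T] (fun w => (f w)%:E) by exact: measurable_int fi.
have : (\int[P]_w `|(f w)%:E| = 0)%E.
  by under eq_integral do rewrite gee0_abs ?lee_fin ?ltW//.
move/(ae_eq_integral_abs P measurableT mf).1 => [N [mN PN0 sub]].
have : P N = 1%E.
  rewrite -(probability_setT P); congr (P _); apply/seteqP; split => // w _.
  by apply: sub => /= /(_ I) [] fw; move: (f0 w); rewrite fw ltxx.
by rewrite PN0 => -[/esym/eqP]; rewrite oner_eq0.
Qed.

End Positivity.

Section CubeTensor.
Context (K : realType) (disp : measure_display) (T : measurableType disp).
Variable P : probability T K.

(** The cube expands into a finite sum of products of a function of [x.1] by a
    function of [x.2]. *)
Lemma integrable_cube_bilinear (n : nat) (f g : 'I_n -> T -> K) :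
  (forall i j k, exists v, has_expectation P (fun w => f i w * f j w * f k w) v) ->
  (forall i j k, exists v, has_expectation P (fun w => g i w * g j w * g k w) v) ->
  (P \x P)%E.-integrable [set: T * T]
    (fun x => ((\sum_i f i x.1 * g i x.2) ^+ 3)%:E).
Proof.
move=> hf hg.
have E (x : T * T) : ((\sum_i f i x.1 * g i x.2) ^+ 3)%:E =
    (\sum_i \sum_j \sum_k
      ((f i x.1 * f j x.1 * f k x.1) * (g i x.2 * g j x.2 * g k x.2))%:E)%E.
  rewrite exprS expr2 big_distrlr big_distrlr /= -sumEFin.
  apply: eq_bigr => i _; rewrite -sumEFin; apply: eq_bigr => j _.
  by rewrite mulr_sumr -sumEFin; apply: eq_bigr => k _; congr EFin; ring.
rewrite (funext E).
have isum := @integrable_sum _ _ K (P \x P)%E setT measurableT.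
apply: (isum) => i _; apply: (isum) => j _; apply: (isum) => k _.
have [u hu] := hf i j k; have [v hv] := hg i j k.
exact: integrable_tensor hu hv.
Qed.

End CubeTensor.

Section MardiaMeasures.
Context (K : realType) (disp : measure_display) (T : measurableType disp).
Variables (P : probability T K) (d : nat) (xi gamma : 'cV[K]_d).
Variables (Sigma : 'M[K]_d) (H : probability (K * K)%type K).
Variables (X : T -> 'cV[K]_d) (R S : T -> K) (Y : T -> 'cV[K]_d).
Hypotheses (hY : GMN P xi Sigma gamma H X R S Y) (gamma0 : gamma != 0).
Hypothesis hmom : forall h k : nat, (h + k <= 4)%N ->
  P.-integrable [set: T] (fun w => (R w ^+ h * S w ^+ k)%:E).
Let pd := gmn_posdef hY.
Let normalX := gmn_normal hY.
Local Notation mu := (joint_moment P R S).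
Local Notation has := (has_expectation P).
Local Notation L := (linear_form X).
Local Notation C := (cov Sigma).
Local Notation cm := (centered_moment P R S).
Local Notation Z := (mixture_form P X R S).
Local Notation alpha := (Num.sqrt ((gamma^T *m invmx Sigma *m gamma) 0 0)).
Local Notation t := (unit_direction Sigma gamma).
Local Notation Q := (residual_mx Sigma gamma).
Local Notation q := (quadratic_form X Q).
Local Notation e i := (delta_mx i 0 : 'cV[K]_d).

Lemma centered_moment02_gt0 : 0 < cm 0 2.
Proof.
apply: (has_expectation_gt0 (has_centered_moment hmom (isT : 0 + 2 <= 4)%N)) => w.
by rewrite expr0 mul1r exprn_gt0// (gmn_scale_gt0 hY).
Qed.

Lemma centered_moment20_ge0 : 0 <= cm 2 0.
Proof.
apply: (has_expectation_ge0 (has_centered_moment hmom (isT : 2 + 0 <= 4)%N)) => w.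
by rewrite expr0 mulr1 sqr_ge0.
Qed.

(** The denominator of [rhobar], which is [mu02] plus the variance of
    [alpha R]. *)
Lemma variance_direction_gt0 : 0 < cm 0 2 + alpha ^+ 2 * cm 2 0.
Proof.
by rewrite ltr_wpDr ?centered_moment02_gt0// mulr_ge0 ?sqr_ge0 ?centered_moment20_ge0.
Qed.

Lemma linear_form_delta i w : L (e i) w = X w i 0.
Proof. by rewrite /linear_form trmx_delta -rowE mxE. Qed.

Lemma gmn_entry i w :
  Y w i 0 = (xi i 0 + mu 1 0 * gamma i 0) + Z (gamma i 0) (e i) w.
Proof.
by rewrite (gmn_sum hY) !mxE /mixture_form linear_form_delta; ring.
Qed.

Lemma gmn_entry_mean i :
  ('E_P[fun w => (Y w i 0)%R] = (xi i 0 + mu 1 0 * gamma i 0)%:E)%E.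
Proof.
apply: expectationE; apply: has_expectation_eq (has_expectationD
  (has_expectation_cst P _) (mixture_form_mean hY hmom (gamma i 0) (e i))) _ _.
  by move=> w; rewrite gmn_entry.
by rewrite addr0.
Qed.

Local Notation y w := ((R w - mu 1 0) *: gamma + S w *: X w).

Lemma gmn_centered w : Y w - mean_vec P Y = y w.
Proof.
apply/matrixP => i j; rewrite (ord1 j) [in LHS]mxE [X in _ + X]mxE.
rewrite /mean_vec [X in _ - X]mxE gmn_entry_mean /= gmn_entry addrC addKr.
by rewrite /mixture_form linear_form_delta !mxE; ring.
Qed.

Lemma gmn_var_mx :
  var_mx P Y = cm 2 0 *: (gamma *m gamma^T) + cm 0 2 *: Sigma.
Proof.
apply/matrixP => i j; rewrite [LHS]mxE covariance.unlock !gmn_entry_mean /=.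
rewrite (expectationE (v := gamma i 0 * gamma j 0 * cm 2 0 + cm 0 2 * Sigma i j)).
  by rewrite !mxE big_ord1 !mxE /=; ring.
apply: has_expectation_eq (mixture_form_pair hY hmom (gamma i 0) (gamma j 0)
  (e i) (e j)) _ _ => [w|].
  rewrite [RHS](_ : _ = (Y w i 0 - (xi i 0 + mu 1 0 * gamma i 0)) *
    (Y w j 0 - (xi j 0 + mu 1 0 * gamma j 0)))// !gmn_entry.
  by congr (_ * _); rewrite addrC addKr.
by rewrite cov_delta.
Qed.

(* This is [1 - rhobar]. *)
Let k := cm 0 2 / (cm 0 2 + alpha ^+ 2 * cm 2 0).

Definition precision_mx := (cm 0 2)^-1 *: (Q + k *: (t *m t^T)).
Local Notation M := precision_mx.

Lemma gmn_precision : invmx (var_mx P Y) = M.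
Proof.
rewrite gmn_var_mx rank_one_update_inverse//.
  by rewrite gt_eqF// centered_moment02_gt0.
by rewrite gt_eqF// variance_direction_gt0.
Qed.

Lemma form_centered (v : 'cV[K]_d) w :
  (v^T *m y w) 0 0 = Z ((v^T *m gamma) 0 0) v w.
Proof. by rewrite mulmxDr -!scalemxAr !mxE /mixture_form /linear_form mulrC !mxE. Qed.

Lemma precision_mx_sym : M^T = M.
Proof.
by rewrite /M linearZ linearD /= linearZ /= trmx_mul trmxK residual_mx_sym.
Qed.

Lemma precision_centered w : M *m y w =
  (cm 0 2)^-1 *: (S w *: (Q *m X w) + (k * Z alpha t w) *: t).
Proof.
rewrite /M -scalemxAl; congr (_ *: _); rewrite mulmxDl; congr (_ + _).
  by rewrite mulmxDr -!scalemxAr residual_mx_gamma// scaler0 add0r.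
rewrite -(scalemxAl k) -(mulmxA t) (mx11_scalar (t^T *m y w)) form_centered.
by rewrite unit_direction_gamma// mul_mx_scalar scalerA.
Qed.

(** The Mahalanobis product is linear in its second argument, with coefficient
    vector [M (Y w - E Y)]; the skewness integral is computed from this form. *)
Lemma gmn_mahalanobis_linear w w' : mahalanobis P Y (Y w) (Y w') =
  Z ((cm 0 2)^-1 * (k * Z alpha t w * alpha)) (M *m y w) w'.
Proof.
rewrite /mahalanobis gmn_precision !gmn_centered.
rewrite -{1}precision_mx_sym -trmx_mul form_centered; congr (Z _ _ _).
rewrite -[LHS]/(linear_form (fun=> gamma) (M *m y w) w) precision_centered.
rewrite linear_formZ linear_formD 2!linear_formZ /linear_form.
rewrite unit_direction_gamma// trmx_mul residual_mx_sym// -(mulmxA _ Q).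
by rewrite residual_mx_gamma// mulmx0 mxE mulr0 add0r.
Qed.

Lemma quadratic_form_linear_form w : L (Q *m X w) w = q w.
Proof. by rewrite /linear_form trmx_mul residual_mx_sym. Qed.

Lemma gmn_mahalanobis_self w : mahalanobis P Y (Y w) (Y w) =
  (cm 0 2)^-1 * (k * Z alpha t w ^+ 2 + S w ^+ 2 * q w).
Proof.
rewrite gmn_mahalanobis_linear precision_centered {1}/mixture_form.
rewrite linear_formZ linear_formD 2!linear_formZ quadratic_form_linear_form.
by rewrite /mixture_form; ring.
Qed.

Lemma cov_precision_centered w : C (M *m y w) (M *m y w) =
  (cm 0 2)^-2 * (k ^+ 2 * Z alpha t w ^+ 2 + S w ^+ 2 * q w).
Proof.
have Qt0 : C (Q *m X w) t = 0.
  rewrite /cov trmx_mul residual_mx_sym// -!mulmxA (mulmxA Q).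
  by rewrite residual_mx_unit_direction// mulmx0 mxE.
have QQ : C (Q *m X w) (Q *m X w) = q w.
  rewrite /cov trmx_mul residual_mx_sym// -!mulmxA (mulmxA Sigma) (mulmxA Q).
  by rewrite (mulmxA Q) residual_mx_idem// /quadratic_form mulmxA.
rewrite precision_centered covZr (covZl pd) (cov_combination pd) QQ Qt0.
rewrite cov_unit_direction//.
by rewrite -exprVn; ring.
Qed.

(** * Mardia's measures *)

Let Qs := residual_mx_sym gamma pd.
Let QSQ := residual_mx_idem pd gamma0.

Lemma has_quadratic_form : has q (d%:R - 1).
Proof.
rewrite -(trace_residual_mx pd gamma0).
exact: (quadratic_form_mean pd normalX Qs).
Qed.

Let measurable_one : measurable_in_vector X (fun=> 1).
Proof. exact: measurable_cst. Qed.

Let has_one_linear : has (fun w => 1 * L t w) 0.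
Proof.
apply: has_expectation_eq (gaussian_odd_moment pd normalX t (k := 1) isT isT) _ _ => // w.
by rewrite mul1r.
Qed.

Lemma expectation_S2_Z : has (fun w => S w ^+ 2 * Z alpha t w) (alpha * cm 1 2).
Proof.
have h := mixture_form_S2 hY hmom alpha measurable_one
  (has_expectation_cst P 1) has_one_linear.
by apply: has_expectation_eq h _ _ => [w|]; rewrite mulr1.
Qed.

Lemma expectation_S2_Z2 : has (fun w => S w ^+ 2 * Z alpha t w ^+ 2)
  (alpha ^+ 2 * cm 2 2 + cm 0 4).
Proof.
have h2 : has (fun w => 1 * L t w ^+ 2) (1 * C t t).
  by apply: has_expectation_eq (gaussian_moment2 pd normalX t) _ _ => [w|];
    rewrite mul1r.
have h := mixture_form_S2sqr hY hmom alpha measurable_one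
  (has_expectation_cst P 1) has_one_linear h2.
apply: has_expectation_eq h _ _ => [w|]; rewrite mulr1//.
by rewrite cov_unit_direction// mulr1.
Qed.

Lemma expectation_Z3 : has (fun w => Z alpha t w ^+ 3)
  (alpha ^+ 3 * cm 3 0 + 3 * alpha * cm 1 2).
Proof.
apply: has_expectation_eq (mixture_form_moment3 hY hmom alpha t) _ _ => //.
by rewrite cov_unit_direction// mulr1.
Qed.

Lemma expectation_Z4 : has (fun w => Z alpha t w ^+ 4)
  (alpha ^+ 4 * cm 4 0 + 6 * alpha ^+ 2 * cm 2 2 + 3 * cm 0 4).
Proof.
apply: has_expectation_eq (mixture_form_moment4 hY hmom alpha t) _ _ => //.
by rewrite cov_unit_direction// expr1n !mulr1.
Qed.

Let measurable_q := measurable_in_quadratic_form (X := X) Qs.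
Let has_q_linear := quadratic_form_linear pd normalX Qs t.

Lemma expectation_S2_Z_q : has (fun w => S w ^+ 2 * Z alpha t w * q w)
  (alpha * cm 1 2 * (d%:R - 1)).
Proof.
exact: (mixture_form_S2 hY hmom alpha measurable_q has_quadratic_form
  has_q_linear).
Qed.

Lemma expectation_S2_Z2_q : has (fun w => S w ^+ 2 * Z alpha t w ^+ 2 * q w)
  ((alpha ^+ 2 * cm 2 2 + cm 0 4) * (d%:R - 1)).
Proof.
have h2 := quadratic_form_square_linear pd normalX Qs
  (residual_mx_unit_direction pd gamma0).
rewrite trace_residual_mx// in h2.
have := mixture_form_S2sqr hY hmom alpha measurable_q has_quadratic_form
  has_q_linear h2.
by rewrite cov_unit_direction// mulr1.
Qed.

Lemma expectation_S4_q2 : has (fun w => S w ^+ 4 * q w ^+ 2)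
  (cm 0 4 * ((d%:R + 1) * (d%:R - 1))).
Proof.
apply: has_expectation_eq (has_mixture hY hmom (isT : 0 + 4 <= 4)%N
  (measurable_in_vectorX 2 (measurable_in_quadratic_form (X := X) Qs))
  (quadratic_form_square pd normalX Qs QSQ)) _ _ => [w|].
  by rewrite expr0 mul1r.
by rewrite trace_residual_mx//; ring.
Qed.

Lemma gmn_kurtosis : mardia_kurtosis P Y =
  ((cm 0 2 ^+ 2)^-1 * ((d%:R + 1) * (d%:R - 1) * cm 0 4
    + 2 * (d%:R - 1) * k * (alpha ^+ 2 * cm 2 2 + cm 0 4)
    + k ^+ 2 * (alpha ^+ 4 * cm 4 0 + 6 * alpha ^+ 2 * cm 2 2 + 3 * cm 0 4)))%:E.
Proof.
rewrite /mardia_kurtosis; apply: expectationE.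
apply: has_expectation_eq (has_expectationZ ((cm 0 2 ^+ 2)^-1)
  (has_expectationD expectation_S4_q2 (has_expectationD
    (has_expectationZ (2 * k) expectation_S2_Z2_q)
    (has_expectationZ (k ^+ 2) expectation_Z4)))) _ _.
  by move=> w; rewrite gmn_mahalanobis_self -exprVn; ring.
by congr (_ * _); ring.
Qed.

Lemma gmn_integrable_cube : (P \x P)%E.-integrable [set: T * T]
  (fun x => (mahalanobis P Y (Y x.1) (Y x.2) ^+ 3)%:E).
Proof.
have E (x : T * T) : (mahalanobis P Y (Y x.1) (Y x.2) ^+ 3)%:E =
  ((\sum_i Z (((e i)^T *m gamma) 0 0) (e i) x.1 *
     Z (((M *m e i)^T *m gamma) 0 0) (M *m e i) x.2) ^+ 3)%:E.
  rewrite /mahalanobis gmn_precision !gmn_centered -mulmxA mxE.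
  congr ((_ ^+ 3)%:E); apply: eq_bigr => i _.
  rewrite mxE -!form_centered trmx_mul precision_mx_sym trmx_delta -mulmxA.
  by rewrite -!rowE !mxE.
rewrite (funext E); apply: (integrable_cube_bilinear
  (f := fun i => Z (((e i)^T *m gamma) 0 0) (e i))
  (g := fun i => Z (((M *m e i)^T *m gamma) 0 0) (M *m e i))) => i j l;
  exact: (mixture_form_triple hY hmom).
Qed.

(** Inner integral: third moment of a mixture form whose coefficients depend on
    [w]. Outer integral: the result is a combination of [Z0^3] and
    [S^2 Z0 q]. *)
Lemma gmn_skewness : mardia_skewness P Y =
  ((cm 0 2 ^+ 3)^-1 * (3 * (d%:R - 1) * k * (alpha * cm 1 2) ^+ 2
    + k ^+ 3 * (alpha ^+ 3 * cm 3 0 + 3 * alpha * cm 1 2) ^+ 2))%:E.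
Proof.
rewrite /mardia_skewness unlock -integral12_prod_meas1; last exact: gmn_integrable_cube.
rewrite /fubini_F /=.
pose c := (cm 0 2)^-1.
under eq_integral => w _.
  under eq_integral => w' _ do rewrite gmn_mahalanobis_linear.
  rewrite (mixture_form_moment3 hY hmom _ _).2 cov_precision_centered.
  over.
have h := has_expectationZ (c ^+ 3) (has_expectationD
   (has_expectationZ (k ^+ 3 * (alpha ^+ 3 * cm 3 0 + 3 * alpha * cm 1 2))
     expectation_Z3)
   (has_expectationZ (3 * k * alpha * cm 1 2) expectation_S2_Z_q)).
apply: etrans (has_expectation_eq h _ _).2 => //.
- by move=> w; rewrite -exprVn /c; ring.
- by rewrite -exprVn -/c; congr (_ * _); ring.
Qed.

End MardiaMeasures.

Theorem mainTheorem6 (K : realType) (disp : measure_display)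
    (T : measurableType disp) (P : probability T K) (d : nat)
    (xi gamma : 'cV[K]_d) (Sigma : 'M[K]_d)
    (H : probability (K * K)%type K)
    (X : T -> 'cV[K]_d) (R S : T -> K) (Y : T -> 'cV[K]_d)
    (hY : GMN P xi Sigma gamma H X R S Y)
    (hgamma : gamma != 0)
    (hmom : forall h k : nat, (h + k <= 4)%N ->
      P.-integrable [set: T] (fun w => (R w ^+ h * S w ^+ k)%:E)) :
  let mu10 : K := joint_moment P R S 1 0 in
  let mu20 : K := joint_moment P R S 2 0 in
  let mu30 : K := joint_moment P R S 3 0 in
  let mu40 : K := joint_moment P R S 4 0 in
  let mu02 : K := joint_moment P R S 0 2 in
  let mu04 : K := joint_moment P R S 0 4 in
  let mu12 : K := joint_moment P R S 1 2 in
  let mu22 : K := joint_moment P R S 2 2 in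
  let alpha : K := Num.sqrt ((gamma^T *m invmx Sigma *m gamma) 0 0) in
  let mubar20 : K := mu20 - mu10 ^+ 2 in
  let rhobar : K := alpha ^+ 2 * mubar20 / (mu02 + alpha ^+ 2 * mubar20) in
  let R0 (w : T) : K := R w - mu10 in
  let T0 (w : T) : K := alpha^-1 * (gamma^T *m invmx Sigma *m X w) 0 0 in
  let Z0 (w : T) : K := alpha * R0 w + S w * T0 w in
  let ES2Z0 : \bar K := ('E_P[fun w => (S w ^+ 2 * Z0 w)%R])%E in
  let ES2Z02 : \bar K := ('E_P[fun w => (S w ^+ 2 * Z0 w ^+ 2)%R])%E in
  let EZ03 : \bar K := ('E_P[fun w => (Z0 w ^+ 3)%R])%E in
  let EZ04 : \bar K := ('E_P[fun w => (Z0 w ^+ 4)%R])%E in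
  (has_normal_law P T0 0 1 /\
   independent2 P (sigma_rv T0) (sigma_rv (fun w => (R w, S w)))) /\
  mardia_skewness P Y =
    ((mu02 ^+ 3)^-1 *
      (3 * (d%:R - 1) * (1 - rhobar) * fine ES2Z0 ^+ 2
       + (1 - rhobar) ^+ 3 * fine EZ03 ^+ 2))%:E /\
  mardia_kurtosis P Y =
    ((mu02 ^+ 2)^-1 *
      ((d%:R + 1) * (d%:R - 1) * mu04
       + 2 * (d%:R - 1) * (1 - rhobar) * fine ES2Z02
       + (1 - rhobar) ^+ 2 * fine EZ04))%:E /\
  ES2Z0 = (alpha * (mu12 - mu10 * mu02))%:E /\
  ES2Z02 =
    (alpha ^+ 2 * (mu22 - 2 * mu12 * mu10 + mu10 ^+ 2 * mu02)
     + mu04)%:E /\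
  EZ03 =
    (alpha ^+ 3 * (mu30 - 3 * mu20 * mu10 + 2 * mu10 ^+ 3)
     + 3 * alpha * (mu12 - mu10 * mu02))%:E /\
  EZ04 =
    (alpha ^+ 4 * (mu40 - 4 * mu30 * mu10 + 6 * mu20 * mu10 ^+ 2
                   - 3 * mu10 ^+ 4)
     + 6 * alpha ^+ 2 * (mu22 - 2 * mu12 * mu10 + mu10 ^+ 2 * mu02)
     + 3 * mu04)%:E.
Proof.
move=> mu10 mu20 mu30 mu40 mu02 mu04 mu12 mu22 alpha mubar20 rhobar R0 T0 Z0.
move=> ES2Z0 ES2Z02 EZ03 EZ04.
have pd := gmn_posdef hY; have normalX := gmn_normal hY.
pose t := unit_direction Sigma gamma.
have [[_ c20 c30 c40] [c02 c04 c12 c22]] := centered_momentE hmom.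
have T0E : T0 = linear_form X t.
  by apply/funext => w; rewrite /linear_form unit_direction_form.
have Z0E : Z0 = mixture_form P X R S alpha t.
  by apply/funext => w; rewrite /Z0 T0E.
have rhoE : 1 - rhobar = mu02 / (mu02 + alpha ^+ 2 * mubar20).
  have := variance_direction_gt0 hY hmom; rewrite c02 c20 => v0.
  by rewrite /rhobar /mubar20 /mu20 /mu10 /mu02 /alpha; field; rewrite gt_eqF.
have e1 : ES2Z0 = (alpha * (mu12 - mu10 * mu02))%:E.
  by rewrite /ES2Z0 Z0E (expectationE (expectation_S2_Z hY hmom)) c12.
have e2 : ES2Z02 =
    (alpha ^+ 2 * (mu22 - 2 * mu12 * mu10 + mu10 ^+ 2 * mu02) + mu04)%:E.
  by rewrite /ES2Z02 Z0E (expectationE (expectation_S2_Z2 hY hgamma hmom)) c22 c04.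
have e3 : EZ03 = (alpha ^+ 3 * (mu30 - 3 * mu20 * mu10 + 2 * mu10 ^+ 3)
    + 3 * alpha * (mu12 - mu10 * mu02))%:E.
  by rewrite /EZ03 Z0E (expectationE (expectation_Z3 hY hgamma hmom)) c30 c12.
have e4 : EZ04 = (alpha ^+ 4 * (mu40 - 4 * mu30 * mu10 + 6 * mu20 * mu10 ^+ 2
                   - 3 * mu10 ^+ 4)
     + 6 * alpha ^+ 2 * (mu22 - 2 * mu12 * mu10 + mu10 ^+ 2 * mu02)
     + 3 * mu04)%:E.
  by rewrite /EZ04 Z0E (expectationE (expectation_Z4 hY hgamma hmom)) c40 c22 c04.
split; [split|].
- have t0 : t != 0.
    apply/eqP => t0; have := cov_unit_direction pd hgamma.
    by rewrite -/t t0 /cov mulmx0 mxE => /esym/eqP; rewrite oner_eq0.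
  rewrite T0E; have := linear_form_normal normalX t0.
  by rewrite cov_unit_direction// sqrtr1.
- rewrite T0E; apply: independent2_subset (gmn_independent hY) => //.
  by apply: sigma_rv_sub_sigma_rvec; exact: measurable_in_vector_linear_form.
rewrite e1 e2 e3 e4 rhoE /=; split.
  by rewrite (gmn_skewness hY hgamma hmom) c02 c12 c20 c30.
by split=> //; rewrite (gmn_kurtosis hY hgamma hmom) c02 c04 c20 c22 c40.
Qed.
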